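(* Consider the $GI^X/M/c/N$ queueing model with partial rejection, with stationary pre-arrival probabilities $\pi(k)$ and batch-size tail $B^c(m)=\sum_{i=m}^{\infty}b(i)$. Then the time-average system size probabilities $p(n)$, $n=0,\dots,N$, are given by \[ p(n)=\frac{\lambda\sum_{k=0}^{n-1}\pi(k)B^c(n-k)}{\min(n,c)\,\mu},\quad n=1,\dots,N;\qquad p(0)=1-\sum_{k=1}^{N}p(k). \]
   Context: The $GI^X/M/c/N$ model with partial rejection: customers arrive in batches to a system with $c\ge 1$ parallel identical servers that can hold at most $N$ customers in total ($N\ge c$). The times between batch arrivals are i.i.d. with distribution function $A(t)$ and mean $1/\lambda$ (so $\lambda$ is the batch arrival rate); batch sizes are i.i.d. copies of $X$ with support in $\{1,2,\dots\}$ and $b(k)=P(X=k)$; service times are i.i.d. exponential with mean $1/\mu$; all are mutually independent. When $n$ customers are present the total service rate is $\min(n,c)\mu$. A batch that would bring the system state above $N$ is partially accepted: exactly enough of its customers are admitted to bring the state to $N$ and the rest of the batch is rejected. $\pi(k)$ is the stationary (limiting) probability that an arriving batch finds $k$ customers in the system. With $X(t)$ the number of customers in the system at time $t$, $p(n)=\lim_{t\to\infty}P\{X(t)=n\}$ is the time-average stationary distribution; these stationary distributions are assumed to exist. *)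

(* Defs.v *)
From HB Require Import structures.
From mathcomp Require Import all_boot all_order all_algebra finmap.
From mathcomp Require Import all_classical all_reals all_analysis.
Set Implicit Arguments.
Unset Strict Implicit.
Unset Printing Implicit Defensive.
Import Order.TTheory GRing.Theory Num.Theory.
Import numFieldNormedType.Exports.
Local Open Scope classical_set_scope.
Local Open Scope ring_scope.

(* One sample path of the GI^X/M/c/N queue with partial rejection and
   first-come first-served servers.  The data are
     q0     the number of customers present at time 0,
     a0     the arrival time of batch 0,
     T j    the time between the arrivals of batches j and j+1,
     X j    the size of batch j,
     V g m  the service time of the m-th customer of group g, where group 0
            consists of the customers present at time 0 and group j+1 of those
            of batch j. *)
Section sample_path.
Context {R : realType}.
Variables c N : nat.

(* In the definitions below, ds lists the departure times of all the customers
   admitted so far, including those still to come. *)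
Definition present (t : R) (ds : seq R) : nat := count (fun d => t < d) ds.

(* A customer arriving at s after all those of ds starts service at the first
   time t >= s at which fewer than c of them are present, that is, at the c-th
   largest element of ds if it exists and exceeds s, and at s otherwise. *)
Definition service_start (s : R) (ds : seq R) : R :=
  Num.max s (nth s (sort >=%R ds) c.-1).

Definition enqueue (s : R) (vs ds : seq R) : seq R :=
  foldl (fun ds v => service_start s ds + v :: ds) ds vs.

Variables (q0 : nat) (a0 : R) (T : nat -> R) (X : nat -> nat)
  (V : nat -> nat -> R).

Definition arrival_time (j : nat) : R := a0 + \sum_(i < j) T i.

(* Departure times of the initial customers and of those admitted from the
   batches 0, ..., j-1. *)
Fixpoint departures (j : nat) : seq R :=
  match j with
  | 0 => enqueue 0 (mkseq (V 0) q0) [::]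
  | i.+1 =>
      let ds := departures i in
      let s := arrival_time i in
      enqueue s (mkseq (V i.+1) (minn (X i) (N - present s ds))) ds
  end.

Definition found (j : nat) : nat := present (arrival_time j) (departures j).

(* Number of batches arrived in [0, t]; it is 0 by convention if there are
   infinitely many of them, which has probability 0. *)
Definition batches (t : R) : nat :=
  #|` fset_set [set j | arrival_time j <= t]|.

Definition in_system (t : R) : nat := present t (departures (batches t)).

End sample_path.

Definition mutually_independent d (Omega : measurableType d) (R : realType)
    (P : probability Omega R) (I : eqType) (G : I -> set (set Omega)) : Prop :=
  forall (J : seq I) (E : I -> set Omega), uniq J ->
    (forall i, i \in J -> G i (E i)) ->
    P (\bigcap_(i in [set` J]) E i) = (\prod_(i <- J) P (E i))%E.

Definition generated_by d d' (Omega : measurableType d) (S : measurableType d')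
    (f : Omega -> S) : set (set Omega) :=
  preimage_set_system setT f measurable.

Inductive source : Type :=
  | Initial
  | Interarrival of nat
  | BatchSize of nat
  | Service of nat & nat.
HB.instance Definition _ := gen_eqMixin source.

(* The number of customers at time 0 and the time until the first batch may
   depend on each other. *)
Definition source_events d (Omega : measurableType d) (R : realType)
    (q0 : Omega -> nat) (a0 : Omega -> R) (T : nat -> Omega -> R)
    (X : nat -> Omega -> nat) (V : nat -> nat -> Omega -> R) (i : source) :
    set (set Omega) :=
  match i with
  | Initial => generated_by (fun w => (q0 w, a0 w))
  | Interarrival j => generated_by (T j)
  | BatchSize j => generated_by (X j)
  | Service g m => generated_by (V g m)
  end.

(* B^c(m) = \sum_(i >= m) b(i) *)
Definition batch_tail (R : realType) (b : nat -> R) (m : nat) : R :=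
  limn (fun n => \sum_(m <= i < n) b i).

(* Main.v *)
Require Import Defs.
From HB Require Import structures.
From mathcomp Require Import all_boot all_order all_algebra finmap.
From mathcomp Require Import all_classical all_reals all_analysis.
From mathcomp Require Import measurable_realfun.
From mathcomp Require Import zify ring lra.
Set Implicit Arguments.
Unset Strict Implicit.
Unset Printing Implicit Defensive.
Import Order.TTheory GRing.Theory Num.Theory.
Import numFieldNormedType.Exports.
Local Open Scope classical_set_scope.
Local Open Scope ring_scope.

(** The proof counts the crossings of level n between consecutive batch
    arrivals.

    Write K for the number present just after the arrival of batch j. Batch j
    takes the state from below n to n or more with probability
    sum_(k < n) P(found_j = k) B^c(n - k), because the size of batch j is
    independent of what it finds; in the limit this is
    crossing_rate = sum_(k < n) pi(k) B^c(n - k). As the laws of found_j and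
    found_(j+1) have the same limit, the probability of a downcrossing, that is
    of K >= n > found_(j+1), has the same limit ([downcrossing_cvg]).

    Downcrossings are departures that take the state from n to n - 1, and a
    customer in service leaves at rate mu. Hence the probability of a
    downcrossing between two arrivals is min(n, c) mu times the expected time
    spent in state n between them ([window_flow]). No Markov property of the
    queue is used for this. For each customer separately, let Y be the queue in
    which his service never ends. His start of service B and Y do not depend on
    his service time V, and up to his departure Y is the actual queue
    ([with_service_presentc]). So V can be integrated out first: the
    probability that Y is n at the time B + V is mu times the expected time in
    (B, B + V] during which Y is n ([compensator]). Summing over customers, the
    left-hand sides count the downcrossings of n, since almost surely no two
    customers leave at the same time, and on the right-hand side min(n, c)
    customers are in service when n are present.

    Summed over J windows, the expected time in state n between arrivals 0 and J
    is therefore asymptotic to J crossing_rate / (min(n, c) mu). It differs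
    from the expected time in state n during the first J / lambda time units by
    o(J): the arrival time of batch J is J / lambda + o(J) in mean
    ([weak_law]), apart from the first arrival time, whose effect is o(J)
    because it is finite ([first_arrival_error]). As the state probabilities
    converge to p(n), the latter time is asymptotic to J p(n) / lambda
    ([cesaro_integral]). Comparing the two gives the formula
    ([level_balance]); only averages enter, so that no renewal theorem is
    needed. The formula for p(0) holds since the state never exceeds N. *)

(** * Counting departures *)

Section order_statistics.
Context {R : realType}.
Implicit Types (s t : R) (ds : seq R).

(** The left limit of [present] in time. Evaluated at the departure time of a
    customer, it still counts that customer. *)
Definition presentc t ds : nat := count (fun d => t <= d) ds.

Lemma presentc_le_size t ds : (presentc t ds <= size ds)%N.
Proof. exact: count_size. Qed.

Lemma present_le_size t ds : (present t ds <= size ds)%N.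
Proof. exact: count_size. Qed.

Lemma present_cons t d ds : present t (d :: ds) = ((t < d)%R + present t ds)%N.
Proof. by []. Qed.

Lemma presentc_cons t d ds :
  presentc t (d :: ds) = ((t <= d)%R + presentc t ds)%N.
Proof. by []. Qed.

(** In a decreasing list, an upward closed predicate selects an initial
    segment. *)
Lemma lt_count_sorted (a : pred R) ds i :
  {homo a : x y / x <= y >-> x ==> y} ->
  sorted >=%R ds -> (i < size ds)%N -> (i < count a ds)%N = a (nth 0 ds i).
Proof.
move=> ha; elim: ds i => [//|x ds IH] i /= xds.
have [ax|nax] := boolP (a x).
  case: i => [|i] /=; first by rewrite ax.
  by rewrite ltnS => ids; rewrite -IH ?(path_sorted xds)// ax; lia.
have alln : all (fun y => ~~ a y) ds.
  have /allP H : all (fun y => y <= x) ds.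
    by apply: order_path_min xds => y1 y2 y3 /= h1 h2; apply: le_trans h1.
  by apply/allP => y /H yx; apply: contra nax; apply/implyP/ha.
have -> : count a ds = 0%N.
  apply/eqP; rewrite -leqn0 leqNgt -has_count; apply/negP => /hasP[y yds ay].
  by move/allP : alln => /(_ _ yds); rewrite ay.
case: i => [|i] /=; first by rewrite (negbTE nax).
by rewrite ltnS => ids; apply/esym/negbTE/(allP alln)/mem_nth.
Qed.

Lemma sort_ge_sorted ds : sorted >=%R (sort >=%R ds).
Proof. by apply: sort_sorted => x y; rewrite orbC le_total. Qed.

(** The c-th largest departure time is before t exactly when fewer than c
    departures are at or after t. Below, the start of service is only known
    through this equivalence, which makes it both measurable and causal. *)
Lemma service_start_lt c s t ds : (0 < c)%N ->
  (service_start c s ds < t) = (s < t) && (presentc t ds < c)%N.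
Proof.
move=> c0; rewrite /service_start gt_max.
have [st|//] := boolP (s < t); rewrite /=.
have [cs|cs] := ltnP c.-1 (size ds); last first.
  rewrite nth_default ?size_sort// st; apply/esym.
  by have := presentc_le_size t ds; lia.
rewrite (set_nth_default 0) ?size_sort// ltNge.
rewrite -(@lt_count_sorted (fun d => t <= d)) ?size_sort ?sort_ge_sorted//; last first.
  by move=> x y xy; apply/implyP => tx; exact: le_trans xy.
by rewrite -[in RHS](prednK c0) ltnS [in RHS]leqNgt /presentc (permP (permEl (perm_sort _ _))).
Qed.

Lemma service_start_ge c s ds : s <= service_start c s ds.
Proof. by rewrite /service_start le_max lexx. Qed.

Lemma presentc_uniq ds i : uniq ds -> sorted >=%R ds -> (i < size ds)%N ->
  presentc (nth 0 ds i) ds = i.+1.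
Proof.
move=> uds sds ids; rewrite /presentc; set a := fun d => _.
have ha : {homo a : x y / x <= y >-> x ==> y}.
  by move=> x y xy; apply/implyP => tx; exact: le_trans xy.
have h1 : (i < count a ds)%N by rewrite lt_count_sorted// /a.
apply/eqP; rewrite eqn_leq h1 andbT leqNgt; apply/negP => h2.
have ids2 : (i.+1 < size ds)%N := leq_trans h2 (count_size _ _).
move: h2; rewrite lt_count_sorted// /a => h3.
have h4 : nth 0 ds i.+1 <= nth 0 ds i.
  have tr : transitive (>=%R : rel R) by move=> x y z h1' h2'; apply: le_trans h1'.
  by apply: (sorted_ltn_nth tr 0 sds i i.+1) => //; rewrite inE.
have /eqP : nth 0 ds i = nth 0 ds i.+1 by apply/eqP; rewrite eq_le h3 h4.
by rewrite nth_uniq//; lia.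
Qed.

(** When the departure times are distinct, the i-th largest of them is seen by
    [presentc] as i. So the sum has a term for the n-th largest departure only,
    and the number present falls below n in the window exactly when that
    departure is in it. *)
Lemma downcrossing_sum s t ds n : uniq ds -> s <= t -> (0 < n)%N ->
  ((n <= present s ds) && (present t ds < n))%N =
  (\sum_(d <- ds) ((s < d <= t)%R && (presentc d ds == n)))%N :> nat.
Proof.
move=> uds st n0.
set S := sort >=%R ds.
have pS : perm_eq S ds by rewrite perm_sort.
have uS : uniq S by rewrite sort_uniq.
have sS : sorted >=%R S := sort_ge_sorted ds.
have cE a : count a ds = count a S by rewrite (permP pS).
rewrite -(perm_big _ pS) /= (big_nth 0) big_mkord.
under eq_bigr => i _ do rewrite {1}/presentc cE -/(presentc _ _) presentc_uniq//.
rewrite /present !cE.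
have ha (u : R) : {homo (fun d => u < d) : x y / x <= y >-> x ==> y}.
  by move=> x y xy; apply/implyP => tx; exact: lt_le_trans xy.
have [nS|nS] := ltnP n.-1 (size S); last first.
  rewrite big1 => [|i _]; last first.
    rewrite (_ : (i.+1 == n) = false) ?andbF//.
    by move: (leq_trans (ltn_ord i) nS); lia.
  rewrite (_ : (n <= _)%N = false)//; apply/negbTE; rewrite -ltnNge.
  by apply: (leq_ltn_trans (leq_trans (present_le_size s S) nS)); lia.
rewrite (bigD1 (Ordinal nS)) //= big1 => [|i /eqP ni]; last first.
  rewrite (_ : (i.+1 == n) = false) ?andbF//; apply/negP => /eqP ni'.
  by apply: ni; apply/val_inj => /=; lia.
rewrite addn0 prednK// eqxx andbT.
have -> : (n <= count (> s) S)%N = (s < nth 0 S n.-1).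
  by rewrite -(lt_count_sorted (ha s))// prednK.
have -> : (count (> t) S < n)%N = (nth 0 S n.-1 <= t).
  by rewrite leNgt -(lt_count_sorted (ha t))// -[in LHS](prednK n0) ltnS leqNgt.
by [].
Qed.

End order_statistics.

(** * Departure lists that agree up to a given time *)

Section agreement.
Context {R : realType}.
Implicit Types (s t tau : R) (ds : seq R).

(** Departure times that an observer of the queue cannot tell apart strictly
    before tau. *)
Definition same_before tau : rel R :=
  fun d d' => (d == d') || ((tau <= d) && (tau <= d')).

Lemma same_before_presentc tau t ds ds' : t <= tau ->
  all2 (same_before tau) ds ds' -> presentc t ds = presentc t ds'.
Proof.
move=> tt; elim: ds ds' => [|d ds IH] [|d' ds']//= /andP[dd' /IH].
rewrite /presentc /= => ->; congr (_ + _)%N.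
case/orP : dd' => [/eqP -> //|/andP[h1 h2]].
by rewrite (le_trans tt h1) (le_trans tt h2).
Qed.

Lemma same_before_present tau t ds ds' : t < tau ->
  all2 (same_before tau) ds ds' -> present t ds = present t ds'.
Proof.
move=> tt; elim: ds ds' => [|d ds IH] [|d' ds']//= /andP[dd' /IH].
rewrite /present /= => ->; congr (_ + _)%N.
case/orP : dd' => [/eqP -> //|/andP[h1 h2]].
by rewrite (lt_le_trans tt h1) (lt_le_trans tt h2).
Qed.

(** By [service_start_lt], a start of service before tau is determined by the
    numbers of departures at or after the times up to tau, on which the lists
    agree. *)
Lemma same_before_start c tau s ds ds' : (0 < c)%N ->
  all2 (same_before tau) ds ds' ->
  same_before tau (service_start c s ds) (service_start c s ds').
Proof.
move=> c0 dd'; rewrite /same_before.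
have H t : t <= tau -> (service_start c s ds < t) = (service_start c s ds' < t).
  by move=> tt; rewrite !service_start_lt// (same_before_presentc tt dd').
have := H _ (lexx tau).
case: (ltP (service_start c s ds)) => [h1 h2|h1 h2]; last first.
  by rewrite orbC leNgt -h2.
rewrite orbF; have [h3|h3|//] := ltgtP (service_start c s ds) (service_start c s ds').
  have := H _ (ltW (esym h2 : service_start c s ds' < tau)).
  by rewrite h3 ltxx.
have := H _ (ltW h1).
by rewrite h3 ltxx.
Qed.

End agreement.

(** * Sample paths *)

(** One realization of all the primitive data. Bundling them makes it possible
    to change one service time while everything else is fixed. *)
Record world (R : realType) := World {
  initial : nat;
  first_arrival : R;
  gap : nat -> R;
  batch : nat -> nat;
  service : nat -> nat -> R }.

Section sample_paths.
Context {R : realType}.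
Variables c N : nat.

Implicit Types (w : world R) (g m j : nat) (t : R).

Definition arrival w j := arrival_time (first_arrival w) (gap w) j.

Definition deps w j :=
  departures c N (initial w) (first_arrival w) (gap w) (batch w) (service w) j.

Definition found_count w j :=
  found c N (initial w) (first_arrival w) (gap w) (batch w) (service w) j.

Definition state w t :=
  in_system c N (initial w) (first_arrival w) (gap w) (batch w) (service w) t.

(** Group 0 consists of the customers present at time 0, group j+1 of those of
    batch j; this is the time at which the group joins. *)
Definition epoch w g := if g is j.+1 then arrival w j else 0.
Definition before w g := if g is j.+1 then deps w j else [::].
Definition admitted w g :=
  if g is j.+1 then minn (batch w j) (N - found_count w j) else initial w.
(** The departure list once the first m customers of group g have joined. Here
    m may exceed the number [admitted] from the group, so that [start] and
    [depart] are defined for all g and m. *)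
Definition line w g m :=
  enqueue c (epoch w g) (mkseq (service w g) m) (before w g).
Definition start w g m := service_start c (epoch w g) (line w g m).
Definition depart w g m := start w g m + service w g m.

Lemma deps_line w g : deps w g = line w g (admitted w g).
Proof. by case: g. Qed.

Lemma line0 w g : line w g 0 = before w g. Proof. by []. Qed.

Lemma mkseqSr T (f : nat -> T) n : mkseq f n.+1 = rcons (mkseq f n) (f n).
Proof. by rewrite /mkseq -{1}addn1 iotaD map_cat cats1. Qed.

Lemma lineS w g m : line w g m.+1 = depart w g m :: line w g m.
Proof. by rewrite /line mkseqSr /enqueue foldl_rcons. Qed.

Lemma deps_sum w J (f : R -> nat) :
  (\sum_(d <- deps w J) f d =
   \sum_(g < J.+1) \sum_(m < admitted w g) f (depart w g m))%N.
Proof.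
have H g m : (\sum_(d <- line w g m) f d =
    \sum_(d <- before w g) f d + \sum_(m' < m) f (depart w g m'))%N.
  elim: m => [|m IH]; first by rewrite line0 big_ord0 addn0.
  by rewrite lineS big_cons IH big_ord_recr /=; lia.
elim: J => [|J IH].
  by rewrite deps_line H big_nil add0n big_ord_recl big_ord0 addn0.
by rewrite deps_line H IH [RHS]big_ord_recr.
Qed.

(** By [service_start_lt], a customer who joins before t has started service
    before t exactly when fewer than c of the earlier customers are still
    present at t: the number in service grows with the number present until it
    reaches c. *)
Lemma in_service_count w J t : (0 < c)%N ->
  (forall g, (g <= J)%N -> epoch w g < t) ->
  (forall g m, 0 <= service w g m) ->
  (\sum_(g < J.+1) \sum_(m < admitted w g)
     (start w g m < t <= depart w g m)%R = minn (presentc t (deps w J)) c)%N.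
Proof.
move=> c_gt0 ep V0.
pose f g m : nat := (start w g m < t <= depart w g m).
have H g m : (g <= J)%N ->
    (minn (presentc t (before w g)) c + \sum_(m' < m) f g m' =
     minn (presentc t (line w g m)) c)%N.
  move=> gJ; elim: m => [|m IH]; first by rewrite line0 big_ord0 addn0.
  rewrite lineS presentc_cons big_ord_recr /= addnA IH /f.
  rewrite {1}/start service_start_lt// ep//=.
  have [h|h] := ltnP (presentc t (line w g m)) c => /=.
    by case: (t <= _) => /=; lia.
  suff -> : t <= depart w g m by lia.
  apply: (@le_trans _ _ (start w g m)); last by rewrite lerDl.
  by rewrite leNgt service_start_lt// negb_and -leqNgt h orbT.
elim: J ep H => [|J IH] ep H.
  rewrite big_ord_recl big_ord0 addn0 deps_line -H//.
  by rewrite /presentc /= min0n.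
rewrite big_ord_recr /= IH => [|g gJ|g m gJ]; first 1 last.
  by apply: ep; lia.
  by apply: H; lia.
exact: H.
Qed.

Lemma start_ge w g m : epoch w g <= start w g m.
Proof. exact: service_start_ge. Qed.

Lemma present_line w g m : (forall m, 0 < service w g m) ->
  present (epoch w g) (line w g m) = (present (epoch w g) (before w g) + m)%N.
Proof.
move=> V0; elim: m => [|m IH]; first by rewrite addn0.
rewrite lineS present_cons IH.
have -> : epoch w g < depart w g m.
  by apply: (le_lt_trans (start_ge w g m)); rewrite /depart ltrDl.
lia.
Qed.

Lemma present_after_arrival w j : (forall m, 0 < service w j.+1 m) ->
  present (arrival w j) (deps w j.+1) = (found_count w j + admitted w j.+1)%N.
Proof. by move=> V0; rewrite deps_line (present_line (g := j.+1)). Qed.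

Lemma present_le (s t : R) ds : s <= t -> (present t ds <= present s ds)%N.
Proof.
by move=> st; apply: sub_count => d; apply: le_lt_trans.
Qed.

Section ordinary.
Variable w : world R.
Hypothesis a0_ge0 : 0 <= first_arrival w.
Hypothesis gap_ge0 : forall j, 0 <= gap w j.

Lemma arrivalS j : arrival w j.+1 = arrival w j + gap w j.
Proof. by rewrite /arrival /arrival_time big_ord_recr addrA. Qed.

Lemma arrival_le j k : (j <= k)%N -> arrival w j <= arrival w k.
Proof.
move=> jk; rewrite -(subnK jk); elim: (_ - _)%N => [//|i IH].
by rewrite addSn arrivalS (le_trans IH)// lerDl.
Qed.

Lemma epoch_le g j : (g <= j.+1)%N -> epoch w g <= arrival w j.
Proof.
case: g => [|g] /=; last by rewrite ltnS; exact: arrival_le.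
move=> _; apply: (@le_trans _ _ (arrival w 0)); last exact: arrival_le.
by rewrite /arrival /arrival_time big_ord0 addr0.
Qed.

Lemma epoch_ge0 g : 0 <= epoch w g.
Proof. by case: g => [//|g]; exact: (@epoch_le 0). Qed.

(** Arrival times are nondecreasing, so the arrivals up to t form an initial
    segment of the indices. *)
Lemma arrivals_lt t j : t < arrival w j ->
  [set k | arrival w k <= t] `<=` `I_j.
Proof.
move=> tj k /= kt; rewrite ltnNge; apply/negP => jk.
by have := arrival_le jk; rewrite leNgt (le_lt_trans kt).
Qed.

Lemma batches_window t j : arrival w j <= t < arrival w j.+1 ->
  batches (first_arrival w) (gap w) t = j.+1.
Proof.
move=> /andP[jt tj]; rewrite /batches.
have -> : [set k | arrival_time (first_arrival w) (gap w) k <= t] = `I_j.+1.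
  apply/seteqP; split; first exact: arrivals_lt.
  by move=> k /=; rewrite ltnS => /arrival_le; move/le_trans; apply.
by rewrite (card_fset_set (n := j.+1)) ?card_eqxx.
Qed.

Lemma batches_lt t j : t < arrival w j ->
  (batches (first_arrival w) (gap w) t <= j)%N.
Proof.
move=> /arrivals_lt tj; rewrite /batches.
set B := [set k | _].
rewrite -[leqRHS](card_fset_set (card_eqxx `I_j)).
apply: fsubset_leq_card; rewrite -fset_set_sub//.
exact: sub_finite_set tj _.
Qed.

Lemma state_window t j : arrival w j <= t < arrival w j.+1 ->
  state w t = present t (deps w j.+1).
Proof. by move=> jt; rewrite /state /in_system (batches_window jt). Qed.

(** Between two consecutive arrivals the departure list is constant. The
    excluded times are those at which the state jumps, where left and right
    limits differ. *)
Lemma window_sum J n t :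
  (forall j, (j <= J)%N -> t != arrival w j) ->
  (forall j, (j < J)%N -> t \notin deps w j.+1) ->
  (\sum_(j < J) ((arrival w j < t <= arrival w j.+1)%R &&
     (presentc t (deps w j.+1) == n)) =
   (arrival w 0 < t <= arrival w J)%R && (state w t == n))%N.
Proof.
elim: J => [|J IH] tarr tdep.
  by rewrite big_ord0; case: (ltP (arrival w 0) t).
rewrite big_ord_recr /= IH; last 2 first.
- by move=> j jJ; apply: tarr; lia.
- by move=> j jJ; apply: tdep; lia.
have [tJ|Jt] := leP t (arrival w J).
  have -> : t <= arrival w J.+1 := le_trans tJ (arrival_le (leqnSn _)).
  by rewrite /= addn0.
rewrite andbF /= add0n.
have -> : arrival w 0 < t := le_lt_trans (arrival_le (leq0n _)) Jt.
have [tJ1/=|//] := leP t (arrival w J.+1).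
rewrite (@state_window _ J); last by rewrite ltW//= lt_neqAle tJ1 tarr.
congr ((_ == n) : nat); apply: eq_in_count => d dd; rewrite le_eqVlt.
suff /negbTE -> : t != d by [].
by apply: contraNneq (tdep _ (leqnn _)) => ->.
Qed.

Hypothesis initial_le : (initial w <= N)%N.

Lemma admitted_le g : (admitted w g <= N)%N.
Proof. by case: g => [//|g] /=; apply: leq_trans (geq_minr _ _) (leq_subr _ _). Qed.

Lemma present_line_le w' g m : (present (epoch w' g) (line w' g m) <=
  present (epoch w' g) (before w' g) + m)%N.
Proof.
elim: m => [|m IH]; first by rewrite addn0.
by rewrite lineS present_cons; case: (_ < _) => /=; lia.
Qed.

Lemma present_deps_le g : (present (epoch w g) (deps w g) <= N)%N.
Proof.
elim: g => [|g IH].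
  by rewrite deps_line (leq_trans (present_line_le _ _ _)).
rewrite deps_line (leq_trans (present_line_le _ _ _))//=.
have gg : (present (arrival w g) (deps w g) <= N)%N.
  by apply: leq_trans IH; apply: present_le; exact: epoch_le.
have : (found_count w g <= N)%N := gg.
rewrite -[present _ _]/(found_count w g).
lia.
Qed.

(** A nonzero value j+1 of [batches] forces arrival j to be at or before t, and
    the number present after arrival j is at most N. *)
Lemma state_le t : (state w t <= N)%N.
Proof.
rewrite /state /in_system; case: (batches _ _ _) (@batches_lt t) => [_|j h].
  rewrite (leq_trans (count_size _ _))// -/(deps w 0) deps_line.
  have H m : size (line w 0 m) = m by elim: m => [//|m IH]; rewrite lineS /= IH.
  by rewrite H.
apply: (@leq_trans (present (epoch w j.+1) (deps w j.+1))).
  apply: present_le => /=; rewrite leNgt; apply/negP => /h; lia.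
exact: present_deps_le.
Qed.

End ordinary.

Section causality.
Variables (w w' : world R).
Hypothesis initialE : initial w = initial w'.
Hypothesis first_arrivalE : first_arrival w = first_arrival w'.
Hypothesis gapE : gap w = gap w'.

Lemma arrival_congr j : arrival w j = arrival w' j.
Proof. by rewrite /arrival first_arrivalE gapE. Qed.

Lemma epoch_congr g : epoch w g = epoch w' g.
Proof. by case: g => [//|j]; exact: arrival_congr. Qed.

Lemma deps_congr J :
  (forall j, (j < J)%N -> batch w j = batch w' j) ->
  (forall g m, (g <= J)%N -> service w g m = service w' g m) ->
  deps w J = deps w' J.
Proof.
elim: J => [|J IH] BE VE.
  rewrite !deps_line /line /= initialE; congr (enqueue _ _ _ _).
  by apply: eq_mkseq => m; rewrite VE.
have dJ : deps w J = deps w' J by apply: IH => *; [apply: BE|apply: VE]; lia.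
have fJ : found_count w J = found_count w' J.
  by rewrite /found_count /found -/(arrival w J) -/(deps w J) arrival_congr dJ.
rewrite !deps_line /line /= dJ arrival_congr fJ BE//; congr (enqueue _ _ _ _).
by apply: eq_mkseq => m; rewrite VE.
Qed.

Lemma found_count_congr J :
  (forall j, (j < J)%N -> batch w j = batch w' j) ->
  (forall g m, (g <= J)%N -> service w g m = service w' g m) ->
  found_count w J = found_count w' J.
Proof.
move=> BE VE.
by rewrite /found_count /found -/(arrival w J) -/(deps w J) arrival_congr deps_congr.
Qed.

Hypothesis batchE : batch w = batch w'.

Lemma line_congr g m :
  (forall g' m', (g' < g)%N -> service w g' m' = service w' g' m') ->
  (forall m', (m' < m)%N -> service w g m' = service w' g m') ->
  line w g m = line w' g m.
Proof.
move=> Eg Em; rewrite /line epoch_congr.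
have -> : before w g = before w' g.
  by case: g Eg {Em} => [//|j] Eg /=; apply: deps_congr => //; rewrite batchE.
congr (enqueue _ _ _ _); apply/eq_in_map => m'.
by rewrite mem_iota => /andP[_]; rewrite add0n; exact: Em.
Qed.

Lemma start_congr g m :
  (forall g' m', (g' < g)%N -> service w g' m' = service w' g' m') ->
  (forall m', (m' < m)%N -> service w g m' = service w' g m') ->
  start w g m = start w' g m.
Proof. by move=> Eg Em; rewrite /start epoch_congr line_congr. Qed.

Lemma admitted_congr g :
  (forall g' m', (g' < g)%N -> service w g' m' = service w' g' m') ->
  admitted w g = admitted w' g.
Proof.
case: g => [//|j] Eg /=; rewrite batchE; congr (minn _ (_ - _)).
by apply: found_count_congr => //; rewrite batchE.
Qed.

Hypothesis c_gt0 : (0 < c)%N.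
Variables (g0 m0 : nat) (tau : R).
Hypothesis service_ge0 : forall g m, 0 <= service w g m.
Hypothesis serviceE :
  forall g m, (g, m) != (g0, m0) -> service w g m = service w' g m.
Hypothesis tau_le : tau <= depart w g0 m0.
Hypothesis tau_le' : tau <= depart w' g0 m0.

(** Causality: a change of the service time of customer (g0, m0) has no effect
    before he leaves, because admissions and starts of service before tau
    depend only on departures before tau. *)
Lemma deps_same_before J : (forall j, (j < J)%N -> arrival w j < tau) ->
  all2 (same_before tau) (deps w J) (deps w' J).
Proof.
have H g m : all2 (same_before tau) (before w g) (before w' g) ->
    all2 (same_before tau) (line w g m) (line w' g m).
  move=> bef; elim: m => [//|m IH]; rewrite !lineS /= IH andbT.
  have [[-> ->]|ne] := eqVneq (g, m) (g0, m0).
    by rewrite /same_before tau_le tau_le' orbT.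
  have /orP[/eqP|/andP[h1 h2]] := same_before_start (epoch w g) c_gt0 IH.
    rewrite {2}epoch_congr -/(start _ _ _) -/(start _ _ _) => se.
    by rewrite /depart se serviceE// /same_before eqxx.
  rewrite epoch_congr in h2.
  rewrite /depart /same_before -serviceE//; apply/orP; right.
  by apply/andP; split; rewrite ler_wpDr.
elim: J => [|J IH] arr; first by rewrite !deps_line /= initialE; exact: H.
have {}IH : all2 (same_before tau) (deps w J) (deps w' J).
  by apply: IH => j jJ; apply: arr; lia.
rewrite !deps_line (_ : admitted w J.+1 = admitted w' J.+1); first exact: H.
rewrite /= batchE; congr (minn _ (_ - _)).
rewrite /found_count /found -!/(arrival _ _) -!/(deps _ _) -arrival_congr.
by apply: same_before_present IH; exact: arr.
Qed.

End causality.
End sample_paths.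

(** * Measurability of the sample path *)

Section measurable_selection.
Context d (S : measurableType d).

Lemma measurable_from_nat d' (S' : measurableType d') (g : nat -> S') :
  measurable_fun setT g.
Proof. by []. Qed.

Lemma measurable_from_bool d' (S' : measurableType d') (g : bool -> S') :
  measurable_fun setT g.
Proof. by []. Qed.

(** A function defined by countably many measurable cases. *)
Lemma measurable_select d' (S' : measurableType d') (k : S -> nat)
    (F : nat -> S -> S') : measurable_fun setT k ->
  (forall n, measurable_fun setT (F n)) ->
  measurable_fun setT (fun x => F (k x) x).
Proof.
move=> mk mF _ Y mY; rewrite setTI.
have -> : (fun x => F (k x) x) @^-1` Y =
    \bigcup_n (k @^-1` [set n] `&` F n @^-1` Y).
  apply/seteqP; split => [x Yx|x [n _ /= [<-//]]].
  by exists (k x).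
apply: bigcupT_measurable => n; apply: measurableI.
  by rewrite -[X in measurable X]setTI; exact: mk.
by rewrite -[X in measurable X]setTI; exact: mF.
Qed.

Lemma measurable_natop (op : nat -> nat -> nat) (f g : S -> nat) :
  measurable_fun setT f -> measurable_fun setT g ->
  measurable_fun setT (fun x => op (f x) (g x)).
Proof.
move=> mf mg; apply: (measurable_select (F := fun n x => op n (g x))) => // n.
exact: (measurableT_comp (measurable_from_nat (op n))).
Qed.

Lemma measurable_natrel (op : nat -> nat -> bool) (f g : S -> nat) :
  measurable_fun setT f -> measurable_fun setT g ->
  measurable_fun setT (fun x => op (f x) (g x)).
Proof.
move=> mf mg; apply: (measurable_select (F := fun n x => op n (g x))) => // n.
exact: (measurableT_comp (measurable_from_nat (op n))).
Qed.

Lemma measurable_nat_of_bool (f : S -> bool) :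
  measurable_fun setT f -> measurable_fun setT (fun x => f x : nat).
Proof. exact: (measurableT_comp (measurable_from_bool nat_of_bool)). Qed.

Lemma measurable_sumn n (F : nat -> S -> nat) :
  (forall i, measurable_fun setT (F i)) ->
  measurable_fun setT (fun x => \sum_(i < n) F i x)%N.
Proof.
move=> mF; elim: n => [|n IH].
  under eq_fun do rewrite big_ord0.
  exact: measurable_cst.
under eq_fun do rewrite big_ord_recr.
exact: (measurable_natop addn).
Qed.

Lemma measurable_set_bool (f : S -> bool) :
  measurable_fun setT f -> measurable [set x | f x].
Proof.
move=> mf; have := mf measurableT [set true] I.
by rewrite setTI; congr measurable; apply/seteqP; split => x /=.
Qed.

Lemma measurable_set_nat (f : S -> nat) k :
  measurable_fun setT f -> measurable [set x | f x = k].
Proof.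
by move=> mf; rewrite -[X in measurable X]setTI; exact: (mf measurableT [set k]).
Qed.

Lemma card_fset_set_nat (e : nat -> bool) J :
  (forall k, (J <= k)%N -> ~~ e k) ->
  #|` fset_set [set k | e k]| = (\sum_(k < J) e k)%N.
Proof.
move=> eJ.
have fs : finite_set [set k | e k].
  apply: (sub_finite_set (B := `I_J)); last exact: finite_II.
  by move=> k /= ek; rewrite ltnNge; apply/negP => /eJ; rewrite ek.
have -> : fset_set [set k | e k] = [fset k in [seq k <- iota 0 J | e k]]%fset.
  apply/fsetP => k; rewrite in_fset_set// !inE mem_filter mem_iota /=.
  apply/idP/andP => [|[ek _]]; last by rewrite inE.
  rewrite inE /= => ek; split => //.
  by rewrite ltnNge; apply/negP => /eJ; rewrite ek.
rewrite card_fseq undup_id ?filter_uniq ?iota_uniq// size_filter -sum1_count.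
rewrite big_mkcond /= -{1}(subn0 J) -/(index_iota 0 J) big_mkord.
by apply: eq_bigr => k _; case: (e k).
Qed.

(** The convention for infinite sets: [fset_set] is then empty. *)
Lemma card_fset_set_unbounded (e : nat -> bool) :
  (forall J, exists2 k, (J <= k)%N & e k) -> #|` fset_set [set k | e k]| = 0%N.
Proof.
move=> ub; have [fs|fs] := pselect (finite_set [set k | e k]); last first.
  by rewrite /fset_set; case: pselect => // _; exact: cardfs0.
have [k Jk ek] := ub (\max_(i <- fset_set [set k | e k]) i).+1.
have : k \in fset_set [set k | e k] by rewrite in_fset_set// inE.
move=> kf; have := @leq_bigmax_seq _ _ xpredT id _ kf isT.
by rewrite leqNgt Jk.
Qed.

(** Where E fails from J on, the cardinal is the J-th partial count; where E
    holds infinitely often it is 0. Both descriptions are countable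
    combinations of measurable sets. *)
Lemma measurable_finite_card (E : nat -> S -> bool) :
  (forall k, measurable_fun setT (E k)) ->
  measurable_fun setT (fun x => #|` fset_set [set k | E k x]|).
Proof.
move=> mE _ Y _; rewrite setTI.
set f := fun x => #|` _|.
pose fin J := \bigcap_(k in [set k | (J <= k)%N]) [set x | ~~ E k x].
have mfin J : measurable (fin J).
  apply: bigcap_measurable => [|k _]; first by exists J => /=.
  by apply: measurable_set_bool; exact: measurable_neg.
pose cnt J x := (\sum_(k < J) E k x)%N.
have mcnt J : measurable_fun setT (cnt J).
  apply: (measurable_sumn J (F := fun k x => E k x : nat)) => k.
  exact: measurable_nat_of_bool.
have fE J x : fin J x -> f x = cnt J x.
  by move=> Jx; apply: card_fset_set_nat => k /Jx.
have f0 x : ~ (\bigcup_J fin J) x -> f x = 0%N.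
  move=> nx; apply: card_fset_set_unbounded => J.
  apply: contra_notP nx => nJ; exists J => // k /= Jk.
  by apply/negP => Ekx; apply: nJ; exists k.
have -> : f @^-1` Y = \bigcup_J (fin J `&` cnt J @^-1` Y) `|`
    (~` (\bigcup_J fin J) `&` [set _ | Y 0%N]).
  apply/seteqP; split => x /=.
    move=> Yx; have [[J _ Jx]|nx] := pselect ((\bigcup_J fin J) x).
      by left; exists J => //; split => //=; rewrite -fE.
    by right; split => //=; rewrite -(f0 _ nx).
  by move=> [[J _ [Jx]]|[nx Y0]] /=; [rewrite -fE|rewrite f0].
apply: measurableU.
  apply: bigcupT_measurable => J; apply: measurableI => //.
  by rewrite -[X in measurable X]setTI; exact: mcnt.
apply: measurableI; first by apply: measurableC; exact: bigcupT_measurable.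
have [Y0|Y0] := pselect (Y 0%N).
  by rewrite (_ : [set _ | _] = setT)//; apply/seteqP; split.
by rewrite (_ : [set _ | _] = set0)//; apply/seteqP; split.
Qed.

End measurable_selection.

Section measurable_lists.
Context d (S : measurableType d) (R : realType).
Implicit Types (L : S -> seq R) (t : S -> R).

(** Measurability of a list of random length; the default value 0 beyond the
    end makes every component a function on the whole of S. *)
Definition measurable_list L := measurable_fun setT (fun x => size (L x)) /\
  forall n, measurable_fun setT (fun x => nth 0 (L x) n).

Lemma measurable_list_nil : measurable_list (fun _ => [::]).
Proof. by split => [|n]; exact: measurable_cst. Qed.

Lemma measurable_list_cons t L : measurable_fun setT t -> measurable_list L ->
  measurable_list (fun x => t x :: L x).
Proof.
move=> mt [msize mnth]; split => [|[|n]] //=.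
exact: (measurableT_comp (measurable_from_nat succn)).
Qed.

Lemma measurable_list_select (k : S -> nat) (F : nat -> S -> seq R) :
  measurable_fun setT k -> (forall n, measurable_list (F n)) ->
  measurable_list (fun x => F (k x) x).
Proof.
move=> mk mF; split => [|n].
  by apply: (measurable_select (F := fun j x => size (F j x))) => // j; case: (mF j).
by apply: (measurable_select (F := fun j x => nth 0 (F j x) n)) => // j; case: (mF j).
Qed.

Lemma measurable_count (a : S -> R -> bool) L : measurable_list L ->
  (forall t, measurable_fun setT t -> measurable_fun setT (fun x => a x (t x))) ->
  measurable_fun setT (fun x => count (a x) (L x)).
Proof.
move=> [msize mnth] ma.
have -> : (fun x => count (a x) (L x)) =
    (fun x => \sum_(i < size (L x)) a x (nth 0%R (L x) i))%N.
  apply/funext => x; rewrite -sum1_count big_mkcond /= (big_nth 0) big_mkord.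
  by apply: eq_bigr => i _; case: (a _ _).
apply: (measurable_select (F := fun n x => \sum_(i < n) a x (nth 0%R (L x) i))%N).
  exact: msize.
move=> n; apply: (measurable_sumn n (F := fun i x => a x (nth 0 (L x) i) : nat)) => i.
by apply: measurable_nat_of_bool; exact: ma.
Qed.

Lemma measurable_present t L : measurable_fun setT t -> measurable_list L ->
  measurable_fun setT (fun x => present (t x) (L x)).
Proof.
by move=> mt mL; apply: measurable_count => // u mu; exact: measurable_fun_ltr.
Qed.

Lemma measurable_presentc t L : measurable_fun setT t -> measurable_list L ->
  measurable_fun setT (fun x => presentc (t x) (L x)).
Proof.
by move=> mt mL; apply: measurable_count => // u mu; exact: measurable_fun_ler.
Qed.

(** By [service_start_lt], the sublevel sets are given by numbers of
    departures. *)
Lemma measurable_service_start c t L : (0 < c)%N ->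
  measurable_fun setT t -> measurable_list L ->
  measurable_fun setT (fun x => service_start c (t x) (L x)).
Proof.
move=> c0 mt mL mD; apply: (measurability _ (RGenInftyO.measurableE R)) => //.
move=> _ [_ [u ->] <-]; rewrite setTI.
have -> : (fun x => service_start c (t x) (L x)) @^-1` `]-oo, u[ =
    [set x | (t x < u) && (presentc u (L x) < c)%N].
  by apply/seteqP; split => x /=; rewrite in_itv /= service_start_lt.
apply: measurable_set_bool; apply: measurable_and.
  by apply: measurable_fun_ltr => //; exact: measurable_cst.
apply: (measurable_natrel (fun a b => (a < b)%N)); last exact: measurable_cst.
by apply: measurable_presentc => //; exact: measurable_cst.
Qed.

End measurable_lists.

Section measurable_paths.
Context d (S : measurableType d) (R : realType) (c N : nat).
Hypothesis c_gt0 : (0 < c)%N.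

Definition measurable_world (W : S -> world R) :=
  [/\ measurable_fun setT (fun x => initial (W x)),
      measurable_fun setT (fun x => first_arrival (W x)),
      forall j, measurable_fun setT (fun x => gap (W x) j),
      forall j, measurable_fun setT (fun x => batch (W x) j) &
      forall g m, measurable_fun setT (fun x => service (W x) g m)].

Variable W : S -> world R.
Hypothesis mW : measurable_world W.

Lemma measurable_gap_sum j :
  measurable_fun setT (fun x => \sum_(i < j) gap (W x) i).
Proof.
by apply: measurable_sum => i; case: mW.
Qed.

Lemma measurable_arrival j : measurable_fun setT (fun x => arrival (W x) j).
Proof.
by apply: measurable_funD; [case: mW|exact: measurable_gap_sum].
Qed.

Lemma measurable_epoch g : measurable_fun setT (fun x => epoch (W x) g).
Proof. by case: g => [|g]; [exact: measurable_cst|exact: measurable_arrival]. Qed.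

Lemma measurable_line_aux g m :
  measurable_list (fun x => before c N (W x) g) ->
  measurable_list (fun x => line c N (W x) g m).
Proof.
move=> mb; elim: m => [//|m IH].
under eq_fun do rewrite lineS.
apply: measurable_list_cons => //; apply: measurable_funD; last by case: mW.
by apply: measurable_service_start => //; exact: measurable_epoch.
Qed.

Lemma measurable_found_count_aux j :
  measurable_list (fun x => deps c N (W x) j) ->
  measurable_fun setT (fun x => found_count c N (W x) j).
Proof. by move=> mj; apply: measurable_present => //; exact: measurable_arrival. Qed.

Lemma measurable_deps j : measurable_list (fun x => deps c N (W x) j).
Proof.
elim: j => [|j IH]; under eq_fun do rewrite deps_line.
  apply: (measurable_list_select (k := fun x => admitted c N (W x) 0)
    (F := fun m x => line c N (W x) 0 m)) => [|m]; first by case: mW.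
  by apply: measurable_line_aux; exact: measurable_list_nil.
apply: (measurable_list_select (k := fun x => admitted c N (W x) j.+1)
    (F := fun m x => line c N (W x) j.+1 m)) => [|m]; last exact: measurable_line_aux.
apply: (measurable_natop (fun a b => minn a (N - b))%N); first by case: mW.
exact: measurable_found_count_aux.
Qed.

Lemma measurable_found_count j : measurable_fun setT (fun x => found_count c N (W x) j).
Proof. exact: measurable_found_count_aux (measurable_deps j). Qed.

Lemma measurable_admitted g : measurable_fun setT (fun x => admitted c N (W x) g).
Proof.
case: g => [|j]; first by case: mW.
apply: (measurable_natop (fun a b => minn a (N - b))%N); first by case: mW.
exact: measurable_found_count.
Qed.

Lemma measurable_line g m : measurable_list (fun x => line c N (W x) g m).
Proof.
by apply: measurable_line_aux; case: g => [|j];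
  [exact: measurable_list_nil|exact: measurable_deps].
Qed.

Lemma measurable_start g m : measurable_fun setT (fun x => start c N (W x) g m).
Proof.
apply: measurable_service_start => //; first exact: measurable_epoch.
exact: measurable_line.
Qed.

Lemma measurable_depart g m : measurable_fun setT (fun x => depart c N (W x) g m).
Proof. by apply: measurable_funD; [exact: measurable_start|case: mW]. Qed.

Lemma measurable_state (t : S -> R) : measurable_fun setT t ->
  measurable_fun setT (fun x => state c N (W x) (t x)).
Proof.
move=> mt; apply: measurable_present => //.
apply: (measurable_list_select
  (k := fun x => batches (first_arrival (W x)) (gap (W x)) (t x))
  (F := fun j x => deps c N (W x) j)); last exact: measurable_deps.
apply: (measurable_finite_card (E := fun k x => arrival (W x) k <= t x)) => k.
by apply: measurable_fun_ler => //; exact: measurable_arrival.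
Qed.

End measurable_paths.

(** * Resampling one of several independent sources *)

Section independence.
Context d (Omega : measurableType d) (R : realType) (P : probability Omega R).
Context (I : eqType) (G : I -> set (set Omega)).
Hypothesis G_setT : forall i, G i setT.
Hypothesis G_setI : forall i, setI_closed (G i).
Hypothesis G_measurable : forall i, G i `<=` measurable.
Hypothesis G_indep : mutually_independent P G.
Variable i0 : I.

Definition others : set (set Omega) := \bigcup_(i in [set i | i != i0]) G i.

Let finite_others : set (set Omega) :=
  [set A | exists J E, [/\ uniq J, i0 \notin J, forall i, i \in J -> G i (E i)
                        & A = \bigcap_(i in [set` J]) E i]].

Let finite_others_setI : setI_closed finite_others.
Proof.
move=> _ _ [J [E [uJ iJ GE ->]]] [J' [E' [uJ' iJ' GE' ->]]].
pose F i := (if i \in J then E i else setT) `&` (if i \in J' then E' i else setT).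
exists (undup (J ++ J')), F; split.
- exact: undup_uniq.
- by rewrite mem_undup mem_cat negb_or iJ.
- by move=> i _; apply: G_setI; case: ifPn => // iJ2; [exact: GE|exact: GE'].
- apply/seteqP; split => [x [h h'] i /=|x h].
    rewrite mem_undup mem_cat => _; split; case: ifPn => // ?; [exact: h|exact: h'].
  split => i /= iJ2; have [] := h i => /=; rewrite ?mem_undup ?mem_cat ?iJ2 ?orbT//.
Qed.

(** The finite intersections of events of the other sources form a pi-system,
    on which the finite measures that send A to P (A `&` B) and to P A * P B
    agree. Hence they agree on the generated sigma-algebra. *)
Lemma others_indep A B : <<s others >> A -> G i0 B -> P (A `&` B) = (P A * P B)%E.
Proof.
move=> sA GB; have mB := G_measurable GB.
have PBfin : P B \is a fin_num by exact: fin_num_measure.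
pose b := NngNum (fine_ge0 (measure_ge0 P B)).
have finm : finite_others `<=` measurable.
  move=> _ [J [E [_ _ GE ->]]]; elim: J GE => [|j J IH] GE.
    by rewrite set_nil bigcap_set0.
  rewrite (_ : [set` j :: J] = j |` [set` J]); last first.
    by apply/seteqP; split => i /=; rewrite inE => /predU1P.
  rewrite bigcap_setU1; apply: measurableI.
    by apply: G_measurable (GE j _); rewrite inE eqxx.
  by apply: IH => i iJ; apply: GE; rewrite inE iJ orbT.
have mE A' : mscale b P A' = (P B * P A')%E by rewrite -[in RHS](fineK PBfin).
(* Both sides as finite measures in A. *)
suff : mrestr P mB A = mscale b P A by rewrite /mrestr mE muleC.
apply: (@g_sigma_algebra_measure_unique _ _ _ finite_others finm (fun=> setT)) => //.
- by move=> _; exists [::], (fun=> setT); split => //; apply/seteqP; split.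
- by rewrite bigcup_const//; exists 0%N.
- move=> _ [J [E [uJ iJ GE ->]]]; rewrite /mrestr [RHS]mE.
  pose F i := if i == i0 then B else E i.
  have FE i : i \in J -> F i = E i.
    by move=> iJ2; rewrite /F ifN//; apply: contraNneq iJ => <-.
  have := @G_indep (i0 :: J) F; rewrite /= iJ uJ big_cons {3}/F eqxx.
  rewrite [X in (_ * X)%E](_ : _ = P (\bigcap_(i in [set` J]) E i)); last first.
    rewrite (G_indep uJ GE); rewrite !big_seq; apply: eq_bigr => i /FE -> //.
  move=> <-//; last first.
    move=> i; rewrite inE => /orP[/eqP ->|iJ2]; first by rewrite /F eqxx.
    by rewrite FE//; exact: GE.
  congr (P _); apply/seteqP; split => [x [h Bx] i /=|x h].
    rewrite inE => /orP[/eqP ->|iJ2]; first by rewrite /F eqxx.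
    by rewrite FE//; exact: h.
  split => [i /= iJ2|]; first by rewrite -FE//; apply: h => /=; rewrite inE iJ2 orbT.
  by have := h i0; rewrite /F eqxx; apply => /=; rewrite inE eqxx.
- move=> _; rewrite /mrestr /=.
  by apply: (le_lt_trans (probability_le1 P _)); [exact: measurableI|exact: ltry].
- apply: sub_sigma_algebra2 sA => A' [i /= ii0 GA'].
  exists [:: i], (fun=> A'); split => //.
  + by rewrite inE eq_sym.
  + by move=> j; rewrite inE => /eqP ->.
  + by rewrite set_cons1 bigcap_set1.
Qed.

End independence.

Section resampling.
Context d (Omega : measurableType d) (R : realType) (P : probability Omega R).
Context (I : eqType) (G : I -> set (set Omega)).
Hypothesis G_setT : forall i, G i setT.
Hypothesis G_setI : forall i, setI_closed (G i).
Hypothesis G_measurable : forall i, G i `<=` measurable.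
Hypothesis G_indep : mutually_independent P G.
Variable i0 : I.
Context d' (S : measurableType d') (Y : {RV P >-> S}).
Hypothesis Y_G : generated_by Y `<=` G i0.

Local Notation Omega0 := (g_sigma_algebraType (others G i0)).

Lemma others_measurable : <<s others G i0 >> `<=` @measurable _ Omega.
Proof.
apply: smallest_sub; first exact: sigma_algebra_measurable.
by move=> A [i _]; exact: G_measurable.
Qed.

Let idm : Omega -> Omega0 := idfun.

Let idm_measurable : measurable_fun setT idm.
Proof. by move=> _ A mA; rewrite setTI; exact: others_measurable. Qed.

HB.instance Definition _ :=
  isMeasurableFun.Build _ _ _ _ idm idm_measurable.

Let graph : Omega -> Omega0 * S := fun w => (idm w, Y w).

Let graph_measurable : measurable_fun setT graph.
Proof. by apply/measurable_fun_pairP. Qed.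

HB.instance Definition _ :=
  isMeasurableFun.Build _ _ _ _ graph graph_measurable.

Local Open Scope ereal_scope.

(** When the first component carries only the sigma-algebra of the other
    sources, the law of the pair (w, Y w) is the product of the law of that
    component and the law of Y, by [others_indep] on rectangles. Measurability
    of f for this smaller sigma-algebra says that f depends on the source i0
    through its second argument only. *)
Lemma ge0_integral_resample (f : Omega0 * S -> \bar R) :
  measurable_fun setT f -> (forall x, 0 <= f x) ->
  \int[P]_w f (w, Y w) = \int[P]_w \int[distribution P Y]_y f (w, y).
Proof.
move=> mf f0.
transitivity (\int[distribution P graph]_z f z).
  by rewrite ge0_integral_distribution.
transitivity (\int[distribution P idm \x distribution P Y]_z f z).
  apply: eq_measure_integral => A mA _; apply/esym.
  apply: product_measure_unique => // B C mB mC.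
  rewrite /distribution /pushforward /=.
  rewrite -(others_indep G_setT G_setI G_measurable G_indep (i0 := i0))//.
  by apply: Y_G; exists C => //; rewrite setTI.
rewrite fubini_tonelli1// ge0_integral_distribution//.
  exact: measurable_fun_fubini_tonelli_F.
by move=> x; apply: integral_ge0.
Qed.

End resampling.

(** * The constant hazard rate of the exponential law *)

Section bool_integrals.
Context {R : realType}.

Definition ind (b : bool) : \bar R := b%:R%:E.

Lemma ind_ge0 b : (0 <= ind b)%E.
Proof. by rewrite lee_fin ler0n. Qed.

Lemma measurable_ind d (S : measurableType d) (f : S -> bool) :
  measurable_fun setT f -> measurable_fun setT (fun x => ind (f x)).
Proof. exact: (measurableT_comp (measurable_from_bool ind)). Qed.

Lemma integral_ind d (S : measurableType d)
    (m : {measure set S -> \bar R}) (f : S -> bool) :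
  measurable_fun setT f -> (\int[m]_x ind (f x) = m [set x | f x])%E.
Proof.
move=> mf; rewrite -[X in m X]setIT -integral_indic//; last exact: measurable_set_bool.
apply: eq_integral => x _; rewrite /ind indicE.
by have -> : (x \in [set x | f x]) = f x by apply/idP/idP; rewrite inE.
Qed.

End bool_integrals.

Section exponential.
Context {R : realType}.
Local Notation leb := (@lebesgue_measure R).

(** The shifted measure and the Lebesgue measure agree on intervals. *)
Lemma lebesgue_measure_shift (b : R) (A : set R) : measurable A ->
  leb ((fun u => b + u) @^-1` A) = leb A.
Proof.
have mshift : measurable_fun setT (fun u : measurableTypeR R => b + u : measurableTypeR R).
  exact: measurable_funD.
pose h : measurableTypeR R -> measurableTypeR R := fun u => b + u.
pose mh := isMeasurableFun.Build _ _ _ _ h mshift.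
pose ph : {mfun _ >-> _} := HB.pack h mh.
move=> mA; apply/esym.
have -> : leb ((fun u => b + u) @^-1` A) = pushforward leb ph A by [].
apply: (lebesgue_measure_unique (mu := pushforward leb ph)) => // _ [[x y]] _ <-.
rewrite [RHS](_ : _ = leb `]x - b, y - b]%classic); last first.
  congr leb; apply/seteqP.
  by split => u /=; rewrite !in_itv /= /h ltrBlDl lerBrDl.
rewrite !lebesgue_measure_itv /= !lte_fin ltrD2r.
by case: ifP => // _; rewrite -!EFinB; congr EFin; lra.
Qed.

Variables (mu : R) (Exp : probability R R).
Hypothesis mu_gt0 : 0 < mu.
Hypothesis ExpE : forall B, measurable B -> Exp B = exponential_prob mu B.

Lemma exponential_lt0 : Exp `]-oo, 0[%classic = 0%E.
Proof.
rewrite ExpE//; apply: integral0_eq => x; rewrite /= in_itv /= => x0.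
rewrite /exponential_pdf patchE ifF//; apply/negbTE/negP.
by rewrite inE /= in_itv /= andbT leNgt x0.
Qed.

Lemma exponential_set1 (x : R) : Exp [set x] = 0%E.
Proof. by rewrite ExpE//; exact: integral_set1. Qed.

Lemma exponential_le0 : Exp `]-oo, 0]%classic = 0%E.
Proof.
have -> : `]-oo, 0]%classic = `]-oo, 0[ `|` [set 0 : R].
  by rewrite setUitv1//.
rewrite measureU//; last first.
  by apply/seteqP; split => // x [] /= + x0; rewrite x0 in_itv /= ltxx.
by rewrite [X in (X + _)%E]exponential_lt0 [X in (_ + X)%E]exponential_set1 adde0.
Qed.

Lemma exponential_tail (u : R) : 0 < u ->
  Exp `[u, +oo[%classic = (expR (- mu * u))%:E.
Proof.
move=> u0.
have E1 : Exp (~` `[0, u[) = (1 - Exp `[0%R, u[%classic)%E.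
  exact: probability_setC.
have E2 : Exp `[0, u[%classic = (1 - (expR (- mu * u))%:E)%E.
  rewrite -(exponential_prob_itv0c mu u0) -ExpE//.
  have -> : `[0, u]%classic = `[0, u[ `|` [set u] by rewrite setUitv1// bnd_simp ltW.
  rewrite measureU//; last first.
    by apply/seteqP; split => // x [] /= + x0; rewrite x0 in_itv /= ltxx andbF.
  by rewrite [X in (_ + X)%E]exponential_set1 adde0.
have E3 : ~` `[0, u[%classic = (`]-oo, 0[%classic `|` `[u, +oo[%classic : set R).
  by rewrite setCitv.
have E4 : Exp (~` `[0, u[) = (Exp `]-oo, 0%R[%classic + Exp `[u, +oo[%classic)%E.
  rewrite E3 measureU//.
  apply/seteqP; split => // x [] /=; rewrite !in_itv /= andbT => x0 ux.
  by have := lt_trans (lt_le_trans u0 ux) x0; rewrite ltxx.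
move: E4; rewrite exponential_lt0 add0e => <-; rewrite E1 E2.
by rewrite -!EFinB opprB addrC subrK.
Qed.

(** The hazard rate is constant: by Tonelli the right-hand side is the integral
    over the positive part of A of mu times the tail of the law, and mu times
    the tail is the density. *)
Lemma exponential_compensator (A : set R) : measurable A ->
  Exp A = (mu%:E * \int[Exp]_v leb (A `&` `]0%R, v]))%E.
Proof.
move=> mA.
pose f (z : R * R) : \bar R := ind ((0 < z.2 <= z.1) && (z.2 \in A)).
have mAb : measurable_fun setT (fun u : R => u \in A).
  apply: (measurable_fun_bool true); rewrite setTI.
  rewrite (_ : _ @^-1` _ = A)//.
  by apply/seteqP; split => z; [exact: set_mem|exact: mem_set].
have mfb : measurable_fun setT (fun z : R * R => (0 < z.2 <= z.1) && (z.2 \in A)).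
  apply: measurable_and; first apply: measurable_and.
  - by apply: measurable_fun_ltr; [exact: measurable_cst|exact: measurable_snd].
  - by apply: measurable_fun_ler; [exact: measurable_snd|exact: measurable_fst].
  - exact: (measurableT_comp mAb measurable_snd).
have mf : measurable_fun setT f by exact: measurable_ind.
transitivity (mu%:E * \int[Exp]_v \int[leb]_u f (v, u))%E; last first.
  congr (_ * _)%E; apply: eq_integral => v _.
  rewrite /f integral_ind /=; last exact: (measurableT_comp mfb (pair1_measurable v)).
  congr (leb _); apply/seteqP; split => u /=.
    by move=> /andP[/andP[h1 h2]]; rewrite inE in_itv /= h1 h2.
  by rewrite in_itv /= => -[uA ->] /=; exact/mem_set.
rewrite (@fubini_tonelli _ _ R (measurableTypeR R) R Exp leb f mf)//; last first.
  by move=> z; exact: ind_ge0.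
have mG : measurable_fun setT (fun u : measurableTypeR R => \int[Exp]_v f (v, u))%E.
  apply: (@measurable_fun_fubini_tonelli_G _ _ R (measurableTypeR R) R Exp f mf).
  by move=> z; exact: ind_ge0.
rewrite -ge0_integralZl//=; last 2 first.
- by move=> u _; apply: integral_ge0 => v _; exact: ind_ge0.
- by rewrite lee_fin ltW.
rewrite ExpE// /exponential_prob integral_mkcond.
apply: ae_eq_integral => //.
- apply/(measurable_restrictT _ _).1 => //; apply/measurable_EFinP.
  exact: measurable_funTS (measurable_exponential_pdf _).
- exact: measurable_funeM.
have : leb.-negligible [set 0 : R].
  by exists [set 0]; split => //; exact: lebesgue_measure_set1.
move=> n0; apply: negligibleS n0 => u /= hu.
apply: contra_notP hu => u0 _.
rewrite integral_ind /=; last exact: (measurableT_comp mfb (pair2_measurable u)).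
have [u_lt0|u_gt0|/esym//] := ltgtP u 0.
  rewrite (_ : [set x | _] = set0) ?measure0 ?mule0; last first.
    by apply/seteqP; split.
  rewrite patchE; case: ifPn => // _.
  rewrite /exponential_pdf patchE ifF//; apply/negbTE/negP.
  by rewrite inE /= in_itv /= andbT leNgt u_lt0.
rewrite patchE; case: ifPn => uA; last first.
  rewrite (_ : [set x | _] = set0) ?measure0 ?mule0//.
  by apply/seteqP; split => x //=; rewrite andbF.
rewrite (_ : [set x | _] = `[u, +oo[%classic); last first.
  by apply/seteqP; split => x /=; rewrite in_itv /= !andbT.
rewrite [X in (_ * X)%E]exponential_tail// -EFinM exponential_pdfE ?ltW//.
Qed.

End exponential.

(** * The queue with one service time replaced *)

Section modified_worlds.
Context {R : realType}.
Implicit Type w : world R.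

Definition with_service w g m v : world R :=
  World (initial w) (first_arrival w) (gap w) (batch w)
    (fun g' m' => if (g', m') == (g, m) then v else service w g' m').

Lemma with_serviceK w g m u v :
  with_service (with_service w g m u) g m v = with_service w g m v.
Proof.
rewrite /with_service /=; congr World.
by apply/funext => g'; apply/funext => m'; case: (_ == _).
Qed.

Lemma with_service_same w g m v : service (with_service w g m v) g m = v.
Proof. by rewrite /= eqxx. Qed.

(** A device to express that a function of the world ignores the size of batch
    j. *)
Definition with_batch w j k : world R :=
  World (initial w) (first_arrival w) (gap w)
    (fun i => if i == j then k else batch w i) (service w).

(** Measurability along every measurable family of worlds and times. Letting
    the parameter space vary allows the same F to be used on the sample space,
    on its product with the time axis, and with a resampled service time. *)
Definition measurable_along (F : world R -> R -> bool) :=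
  forall d (S : measurableType d) (W : S -> world R) (t : S -> R),
  measurable_world W -> measurable_fun setT t ->
  measurable_fun setT (fun x => F (W x) (t x)).

End modified_worlds.

Section model.
Context d (Omega : measurableType d) (R : realType) (P : probability Omega R).
Variables (q0 : {RV P >-> nat}) (a0 : {RV P >-> R}).
Variables (T : nat -> {RV P >-> R}) (X : nat -> {RV P >-> nat}).
Variable V : nat -> nat -> {RV P >-> R}.
Local Notation G := (source_events q0 a0 T X V).
Hypothesis indep : mutually_independent P G.

Definition model (w : Omega) : world R :=
  World (q0 w) (a0 w) (T ^~ w) (X ^~ w) (fun g m => V g m w).

Lemma generated_by_setT d' (S : measurableType d') (f : Omega -> S) :
  generated_by f setT.
Proof. by exists setT => //; rewrite setTI preimage_setT. Qed.

Lemma generated_by_setI d' (S : measurableType d') (f : Omega -> S) :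
  setI_closed (generated_by f).
Proof.
move=> _ _ [A mA <-] [B mB <-]; exists (A `&` B); first exact: measurableI.
by rewrite !setTI preimage_setI.
Qed.

Lemma generated_by_measurable d' (S : measurableType d') (f : Omega -> S) :
  measurable_fun setT f -> generated_by f `<=` measurable.
Proof. by move=> mf _ [A mA <-]; exact: mf. Qed.

Lemma source_setT i : G i setT.
Proof. by case: i => [|j|j|g m]; exact: generated_by_setT. Qed.

Lemma source_setI i : setI_closed (G i).
Proof. by case: i => [|j|j|g m]; exact: generated_by_setI. Qed.

Lemma source_measurable i : G i `<=` measurable.
Proof.
case: i => [|j|j|g m]; apply: generated_by_measurable => //.
by apply/measurable_fun_pairP; split.
Qed.

Lemma measurable_fun_others i k d' (S : measurableType d') (f : Omega -> S) :
  k != i -> generated_by f `<=` G k ->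
  measurable_fun setT (f : g_sigma_algebraType (others G i) -> S).
Proof.
move=> ki fG _ A mA; apply: sub_sigma_algebra; exists k => //.
by apply: fG; exists A.
Qed.

Lemma generated_by_comp d' (S : measurableType d') d'' (S' : measurableType d'')
    (f : Omega -> S) (h : S -> S') : measurable_fun setT h ->
  generated_by (h \o f) `<=` generated_by f.
Proof.
move=> mh _ [A mA <-]; exists (h @^-1` A); last by rewrite comp_preimage.
by rewrite -[X in measurable X]setTI; exact: mh.
Qed.

Section others.
Variable i : source.
Local Notation Omega0 := (g_sigma_algebraType (others G i)).

Lemma others_initial : Initial != i -> measurable_fun setT (q0 : Omega0 -> nat).
Proof.
move=> ki; apply: (measurable_fun_others ki).
exact: (@generated_by_comp _ _ _ _ (fun w => (q0 w, a0 w)) fst measurable_fst).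
Qed.

Lemma others_first_arrival : Initial != i -> measurable_fun setT (a0 : Omega0 -> R).
Proof.
move=> ki; apply: (measurable_fun_others ki).
exact: (@generated_by_comp _ _ _ _ (fun w => (q0 w, a0 w)) snd measurable_snd).
Qed.

Lemma others_gap j : Interarrival j != i -> measurable_fun setT (T j : Omega0 -> R).
Proof. by move=> ki; exact: (measurable_fun_others ki). Qed.

Lemma others_batch j : BatchSize j != i -> measurable_fun setT (X j : Omega0 -> nat).
Proof. by move=> ki; exact: (measurable_fun_others ki). Qed.

Lemma others_service g m : Service g m != i -> measurable_fun setT (V g m : Omega0 -> R).
Proof. by move=> ki; exact: (measurable_fun_others ki). Qed.

End others.

Lemma measurable_model : measurable_world model.
Proof. by split => /= *. Qed.

(** Once the service time is replaced by the second component, the world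
    depends on the other sources only, hence is measurable for their
    sigma-algebra. *)
Lemma measurable_with_service g m : measurable_world
  (fun z : g_sigma_algebraType (others G (Service g m)) * R =>
     with_service (model z.1) g m z.2).
Proof.
split => [||j|j|g' m'] /=.
- apply: (measurableT_comp _ measurable_fst); apply: others_initial.
  by apply/eqP.
- apply: (measurableT_comp _ measurable_fst); apply: others_first_arrival.
  by apply/eqP.
- apply: (measurableT_comp _ measurable_fst); apply: others_gap.
  by apply/eqP.
- apply: (measurableT_comp _ measurable_fst); apply: others_batch.
  by apply/eqP.
- have [_|/eqP ne] := eqVneq (g', m') (g, m); first exact: measurable_snd.
  apply: (measurableT_comp _ measurable_fst); apply: others_service.
  by apply/eqP => -[gg mm]; apply: ne; rewrite gg mm.
Qed.

Lemma measurable_with_batch j k : measurable_world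
  (fun z : g_sigma_algebraType (others G (BatchSize j)) =>
     with_batch (model z) j k).
Proof.
split => [||i|i|g' m'] /=.
- by apply: others_initial; apply/eqP.
- by apply: others_first_arrival; apply/eqP.
- by apply: others_gap; apply/eqP.
- have [_|/eqP ne] := eqVneq i j; first exact: measurable_cst.
  by apply: others_batch; apply/eqP => -[].
- by apply: others_service; apply/eqP.
Qed.

Variables (mu : R).
Hypothesis mu_gt0 : 0 < mu.
Hypothesis V_distr : forall g m B, measurable B ->
  distribution P (V g m) B = exponential_prob mu B.
Local Notation leb := (@lebesgue_measure R).

Section compensator.
Variables (g m : nat) (F : world R -> R -> bool) (B : world R -> R).
Hypothesis F_measurable : measurable_along F.
Hypothesis B_measurable : forall d' (S : measurableType d') (W : S -> world R),
  measurable_world W -> measurable_fun setT (fun x => B (W x)).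
Hypothesis F_free : forall w v t, F (with_service w g m v) t = F w t.
Hypothesis B_free : forall w v, B (with_service w g m v) = B w.
Local Open Scope ereal_scope.

(** Given all the other sources, the customer who starts service at B leaves at
    constant rate mu while in service. So the probability that F holds when he
    leaves is mu times the expected time he spends in service while F holds.
    This needs that neither F nor B looks at his service time: then
    [ge0_integral_resample] makes the service time an integration variable, and
    [exponential_compensator] applies to the section of F, shifted by B. *)
Lemma compensator :
  P [set w | F (model w) (B (model w) + V g m w)%R] =
  mu%:E * \int[P]_w \int[leb]_t
    ind ((B (model w) < t <= B (model w) + V g m w)%R && F (model w) t).
Proof.
set Omega0 := g_sigma_algebraType (others G (Service g m)).
pose W (z : Omega0 * R) := with_service (model z.1) g m z.2.
have mW : measurable_world W := measurable_with_service g m.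
have resample := ge0_integral_resample source_setT source_setI
  source_measurable indep (i0 := Service g m) (Y := V g m) (@subset_refl _ _).
pose f1 (z : Omega0 * R) : \bar R := ind (F (W z) (B (W z) + z.2)%R).
have mf1 : measurable_fun setT f1.
  apply: measurable_ind; apply: F_measurable => //.
  by apply: measurable_funD; [exact: B_measurable|exact: measurable_snd].
have mF1 : measurable_fun setT (fun w => F (model w) (B (model w) + V g m w)%R).
  apply: F_measurable; first exact: measurable_model.
  by apply: measurable_funD => //; apply: B_measurable; exact: measurable_model.
rewrite -integral_ind//.
transitivity (\int[P]_w f1 (w, V g m w)).
  by apply: eq_integral => w _; rewrite /f1 /W /= F_free B_free.
rewrite resample//; last by move=> z; exact: ind_ge0.
pose f2b (z : Omega0 * R * measurableTypeR R) : bool :=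
  (B (W z.1) < z.2 <= B (W z.1) + z.1.2)%R && F (W z.1) z.2.
pose f2 (z : Omega0 * R) : \bar R := \int[leb]_t ind (f2b (z, t)).
have mW1 : measurable_world (fun z : Omega0 * R * measurableTypeR R => W z.1).
  case: mW => h1 h2 h3 h4 h5.
  split => [||j|j|g' m']; [exact: (measurableT_comp h1 measurable_fst)
    |exact: (measurableT_comp h2 measurable_fst)
    |exact: (measurableT_comp (h3 j) measurable_fst)
    |exact: (measurableT_comp (h4 j) measurable_fst)
    |exact: (measurableT_comp (h5 g' m') measurable_fst)].
have mf2b : measurable_fun setT f2b.
  apply: measurable_and; first apply: measurable_and.
  - by apply: measurable_fun_ltr; [exact: B_measurable|exact: measurable_snd].
  - apply: measurable_fun_ler; first exact: measurable_snd.
    apply: measurable_funD; first exact: B_measurable.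
    exact: (measurableT_comp measurable_snd measurable_fst).
  - exact: F_measurable.
have mf2 : measurable_fun setT f2.
  apply: (@measurable_fun_fubini_tonelli_F _ _ (Omega0 * R)%type (measurableTypeR R) R leb
    (fun z => ind (f2b z))); first exact: measurable_ind.
  by move=> z; exact: ind_ge0.
have f20 z : 0 <= f2 z by apply: integral_ge0 => t _; exact: ind_ge0.
transitivity (mu%:E * \int[P]_w f2 (w, V g m w)); last first.
  congr (_ * _); apply: eq_integral => w _; apply: eq_integral => t _.
  by rewrite /f2b /W /= F_free B_free.
rewrite resample// -ge0_integralZl//=; last first.
- by rewrite lee_fin ltW.
- by move=> w _; apply: integral_ge0.
- move=> _ A mA; rewrite setTI; apply: (others_measurable source_measurable).
  rewrite -[X in <<s _ >> X]setTI.
  exact: (measurable_fun_fubini_tonelli_F f2 mf2 f20 measurableT A mA).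
apply: eq_integral => w _.
pose h u := F (model w) (B (model w) + u)%R.
have mh : measurable_fun setT h.
  apply: (F_measurable (W := fun=> model w)); last exact: measurable_funD.
  by split => *; exact: measurable_cst.
have mf2w v : measurable_fun setT (fun t : measurableTypeR R => f2b (w, v, t)).
  apply: (measurableT_comp mf2b).
  exact: (@pair1_measurable _ _ (Omega0 * R)%type (measurableTypeR R) (w, v)).
transitivity (distribution P (V g m) [set u | h u]).
  rewrite -integral_ind//.
  by apply: eq_integral => u _; rewrite /f1 /W /= F_free B_free.
rewrite (exponential_compensator mu_gt0 (V_distr g m)); last by apply: measurable_set_bool.
congr (_ * _); apply: eq_integral => v _.
rewrite /f2 integral_ind//.
rewrite -[RHS](lebesgue_measure_shift (B (model w))); last exact: (measurable_set_bool (mf2w v)).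
congr (leb _); apply/seteqP; split => u /=.
  rewrite in_itv /= => -[hu /andP[u0 uv]].
  by rewrite /f2b /W /= F_free B_free ltrDl lerD2l u0 uv.
rewrite /f2b /W /= F_free B_free ltrDl lerD2l in_itv /=.
by move=> /andP[-> hu].
Qed.

End compensator.

End model.

(** * Identities on almost every sample path *)

Section good_worlds.
Context {R : realType}.
Variables c N : nat.
Hypothesis c_gt0 : (0 < c)%N.
Implicit Types (w : world R) (t v : R).

(** The order in which the customers join. *)
Definition earlier (i k : nat * nat) : bool :=
  (i.1 < k.1)%N || ((i.1 == k.1) && (i.2 < k.2)%N).

(** Properties that hold almost surely; the last one excludes simultaneous
    departures. *)
Definition good w :=
  [/\ (initial w <= N)%N, 0 <= first_arrival w, forall j, 0 <= gap w j,
      forall g m, 0 < service w g m &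
      forall g' m' g m, earlier (g', m') (g, m) ->
        depart c N w g' m' != depart c N w g m].

Lemma mem_line w g m x : x \in line c N w g m ->
  exists i, earlier i (g, m) /\ x = depart c N w i.1 i.2.
Proof.
elim: g m => [|g IHg] m; elim: m => [|m IHm].
- by rewrite line0.
- rewrite lineS inE => /predU1P[->|/IHm[i [il ->]]].
    by exists (0%N, m); rewrite /earlier /=; split => //; lia.
  by exists i; split => //; move: il; rewrite /earlier /=; lia.
- rewrite line0 /= deps_line => /IHg[i [il ->]].
  by exists i; split => //; move: il; rewrite /earlier /=; lia.
- rewrite lineS inE => /predU1P[->|/IHm[i [il ->]]].
    by exists (g.+1, m); rewrite /earlier /=; split => //; lia.
  by exists i; split => //; move: il; rewrite /earlier /=; lia.
Qed.

Lemma good_uniq w J : good w -> uniq (deps c N w J).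
Proof.
case=> _ _ _ _ tie; rewrite deps_line.
have step g m : uniq (before c N w g) -> uniq (line c N w g m).
  move=> ub; elim: m => [//|m IH]; rewrite lineS /= IH andbT.
  apply/negP => /mem_line[[g' m'] [/tie ne /= e]].
  by rewrite e eqxx in ne.
by elim: J => [|J IH]; apply: step => //=; rewrite deps_line.
Qed.

(** With service time t the customer leaves at t or later, since services start
    at nonnegative times; in the actual world he also leaves at t or later. By
    [deps_same_before] the two worlds then have the same number of departures
    at or after t. *)
Lemma with_service_presentc w g m j t : good w ->
  arrival w j < t -> t <= depart c N w g m ->
  presentc t (deps c N (with_service w g m t) j.+1) =
  presentc t (deps c N w j.+1).
Proof.
case=> _ a0 ga V0 _ jt td; apply/esym.
apply: (@same_before_presentc _ t) => //.
apply: (@deps_same_before _ c N w _ _ _ _ _ c_gt0 g m) => //=.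
- by move=> g' m'; exact: ltW.
- by move=> g' m' /negbTE; rewrite xpair_eqE => ->.
- rewrite /depart with_service_same lerDr.
  by apply: (le_trans _ (start_ge _ _ _ _ _)); exact: epoch_ge0.
- move=> j' jj; apply: le_lt_trans jt; apply: arrival_le => //; lia.
Qed.

(** At a time t in the window after arrival j, there are n customers present if
    customer (g, m) is still there. Read at his departure time, this says that
    his departure takes the state from n to n-1. Giving him the service time t,
    rather than his own, makes the event independent of his actual service
    time. *)
Definition departure_event (g m j n : nat) w t : bool :=
  [&& (m < admitted c N w g)%N, arrival w j < t <= arrival w j.+1 &
      presentc t (deps c N (with_service w g m t) j.+1) == n].

Lemma sum_admitted w g (f : nat -> nat) : good w ->
  (\sum_(m < admitted c N w g) f m =
   \sum_(m < N) (m < admitted c N w g) * f m)%N.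
Proof.
case=> q0 _ _ _ _.
rewrite (big_ord_widen _ f (admitted_le c q0 g)) big_mkcond.
by apply: eq_bigr => m _; case: ifP; rewrite ?mul1n.
Qed.

(** A downcrossing of n in a window is the departure of exactly one customer,
    as in [downcrossing_sum]. *)
Lemma downcrossing_departures w j n : good w -> (0 < n)%N ->
  ((n <= present (arrival w j) (deps c N w j.+1)) &&
   (found_count c N w j.+1 < n))%N =
  (\sum_(i : 'I_j.+2 * 'I_N)
     departure_event i.1 i.2 j n w (depart c N w i.1 i.2))%N :> nat.
Proof.
move=> gw n0; have [_ a0 ga V0 _] := gw.
rewrite downcrossing_sum ?good_uniq//; last exact: arrival_le.
rewrite deps_sum -(pair_bigA _ (fun (g : 'I_j.+2) (m : 'I_N) =>
  departure_event g m j n w (depart c N w g m) : nat)) /=.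
apply: eq_bigr => g _.
rewrite (sum_admitted _ (fun m => (arrival w j < depart c N w g m <= arrival w j.+1)%R &&
  (presentc (depart c N w g m) (deps c N w j.+1) == n) : nat) gw).
apply: eq_bigr => m _; rewrite /departure_event; case: (m < _)%N; rewrite ?mul0n ?mul1n//=.
case: (ltP (arrival w j)) => //= jt.
by rewrite with_service_presentc.
Qed.

(** While n customers are present, min(n, c) of them are in service. *)
Lemma in_service_window w j n t : good w ->
  (\sum_(i : 'I_j.+2 * 'I_N)
     ((start c N w i.1 i.2 < t <= depart c N w i.1 i.2)%R &&
      departure_event i.1 i.2 j n w t))%N =
  (minn n c * ((arrival w j < t <= arrival w j.+1)%R &&
     (presentc t (deps c N w j.+1) == n)))%N.
Proof.
move=> gw; have [_ a0 ga V0 _] := gw.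
rewrite -(pair_bigA _ (fun (g : 'I_j.+2) (m : 'I_N) =>
  (start c N w g m < t <= depart c N w g m)%R &&
      departure_event g m j n w t : nat)) /=.
have [jt|jt] := boolP (arrival w j < t <= arrival w j.+1); last first.
  rewrite muln0 big1// => g _; rewrite big1// => m _.
  by rewrite /departure_event (negbTE jt) /= andbF andbF.
have [/eqP pn|pn] := boolP (presentc t (deps c N w j.+1) == n); last first.
  rewrite muln0 big1// => g _; rewrite big1// => m _.
  rewrite /departure_event jt /=.
  have [td|_] := leP t (depart c N w g m); last by rewrite andbF.
  by rewrite with_service_presentc ?(negbTE pn) ?andbF//; case/andP: jt.
have [jt1 _] := andP jt.
rewrite -pn muln1 -(in_service_count N c_gt0); last 2 first.
- by move=> g gj; apply: le_lt_trans jt1; exact: epoch_le.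
- by move=> g m; exact: ltW.
apply: eq_bigr => g _.
rewrite (sum_admitted _ (fun m =>
  (start c N w g m < t <= depart c N w g m)%R : nat) gw).
apply: eq_bigr => m _; rewrite /departure_event jt /=.
case: (m < _)%N => //=; last by rewrite andbF.
rewrite mul1n; have [td|_] := leP t (depart c N w g m); last by rewrite andbF.
by rewrite with_service_presentc// pn eqxx andbT.
Qed.

Lemma measurable_departure_event g m j n :
  measurable_along (departure_event g m j n).
Proof.
move=> d S W t mW mt.
have mWt : measurable_world (fun x => with_service (W x) g m (t x)).
  case: mW => h1 h2 h3 h4 h5; split => //= g' m'.
  by case: ((g', m') == (g, m)).
apply: measurable_and.
  apply: (measurable_natrel (fun a b => (a < b)%N)); first exact: measurable_cst.
  exact: measurable_admitted.
apply: measurable_and; first apply: measurable_and.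
- by apply: measurable_fun_ltr => //; exact: measurable_arrival.
- by apply: measurable_fun_ler => //; exact: measurable_arrival.
apply: (measurable_natrel (fun a b => a == b)); last exact: measurable_cst.
by apply: measurable_presentc => //; exact: measurable_deps.
Qed.

Lemma with_service_start w g m v g' m' : earlier (g', m') (g, m.+1) ->
  start c N (with_service w g m v) g' m' = start c N w g' m'.
Proof.
rewrite /earlier /= => e; apply: start_congr => //= [g2 m2 h|m2 h].
  by rewrite ifN// xpair_eqE; lia.
by rewrite ifN// xpair_eqE; lia.
Qed.

Lemma with_service_depart w g m v g' m' : earlier (g', m') (g, m) ->
  depart c N (with_service w g m v) g' m' = depart c N w g' m'.
Proof.
move=> e; rewrite /depart with_service_start /=.
  rewrite ifN// xpair_eqE; move: e; rewrite /earlier /=; lia.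
by move: e; rewrite /earlier /=; lia.
Qed.

Lemma with_service_admitted w g m v :
  admitted c N (with_service w g m v) g = admitted c N w g.
Proof.
apply: admitted_congr => //= g2 m2 h.
by rewrite ifN// xpair_eqE; lia.
Qed.

Lemma departure_event_free w g m j n v t :
  departure_event g m j n (with_service w g m v) t = departure_event g m j n w t.
Proof.
by rewrite /departure_event with_service_admitted with_serviceK.
Qed.

End good_worlds.

(** * The rate of downcrossings *)

Section time_integrals.
Context d (Omega : measurableType d) (R : realType).
Local Notation leb := (@lebesgue_measure R).
Local Open Scope ereal_scope.

Lemma sum_natE (I : finType) (f : I -> nat) :
  ((\sum_i f i)%N%:R : R)%:E = \sum_i (f i)%:R%:E.
Proof. by rewrite natr_sum sumEFin. Qed.

Lemma measurable_time_integral (f : Omega * measurableTypeR R -> bool) :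
  measurable_fun setT f ->
  measurable_fun setT (fun w => \int[leb]_t ind (f (w, t))).
Proof.
move=> mf; apply: (@measurable_fun_fubini_tonelli_F _ _ Omega (measurableTypeR R)
  R leb (fun z => ind (f z))); first exact: measurable_ind.
by move=> z; exact: ind_ge0.
Qed.

Lemma measurable_time_slice (f : Omega * measurableTypeR R -> bool) w :
  measurable_fun setT f -> measurable_fun setT (fun t : measurableTypeR R => f (w, t)).
Proof.
move=> mf; apply: (measurableT_comp mf).
exact: (@pair1_measurable _ _ Omega (measurableTypeR R) w).
Qed.

Lemma time_integral_ge0 (f : Omega * measurableTypeR R -> bool) w :
  0 <= \int[leb]_t ind (f (w, t)).
Proof. by apply: integral_ge0 => t _; exact: ind_ge0. Qed.

Lemma integral_sum_ind (P : {measure set Omega -> \bar R}) (I : finType)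
    (f : I -> Omega * measurableTypeR R -> bool) :
  (forall i, measurable_fun setT (f i)) ->
  \int[P]_w \int[leb]_t (\sum_i (f i (w, t) : nat))%N%:R%:E =
  \sum_i \int[P]_w \int[leb]_t ind (f i (w, t)).
Proof.
move=> mf; rewrite -ge0_integral_sum//; last 2 first.
- by move=> i; exact: measurable_time_integral.
- by move=> i w _; exact: time_integral_ge0.
apply: eq_integral => w _; rewrite -ge0_integral_sum//; last 2 first.
- by move=> i; apply: measurable_ind; exact: measurable_time_slice.
- by move=> i t _; exact: ind_ge0.
by apply: eq_integral => t _; rewrite sum_natE.
Qed.

Lemma integral_scale_ind (P : {measure set Omega -> \bar R}) (k : nat)
    (f : Omega * measurableTypeR R -> bool) : measurable_fun setT f ->
  \int[P]_w \int[leb]_t (k * f (w, t))%N%:R%:E =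
  k%:R%:E * \int[P]_w \int[leb]_t ind (f (w, t)).
Proof.
move=> mf; rewrite -ge0_integralZl//; last 2 first.
- exact: measurable_time_integral.
- by move=> w _; exact: time_integral_ge0.
apply: eq_integral => w _; rewrite -ge0_integralZl//; last 2 first.
- exact: (measurable_ind (measurable_time_slice w mf)).
- by move=> t _; exact: ind_ge0.
by apply: eq_integral => t _; rewrite natrM EFinM.
Qed.

Lemma ae_of_probability0 (P : {measure set Omega -> \bar R}) (f : Omega -> bool) :
  measurable_fun setT f -> P [set w | ~~ f w] = 0 -> {ae P, forall w, f w}.
Proof.
move=> mf f0; exists [set w | ~~ f w]; split => //.
  exact: (measurable_set_bool (measurable_neg mf)).
by move=> w /= /negP.
Qed.

End time_integrals.

Section flow.
Context d (Omega : measurableType d) (R : realType) (P : probability Omega R).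
Variables (q0 : {RV P >-> nat}) (a0 : {RV P >-> R}).
Variables (T : nat -> {RV P >-> R}) (X : nat -> {RV P >-> nat}).
Variable V : nat -> nat -> {RV P >-> R}.
Hypothesis indep : mutually_independent P (source_events q0 a0 T X V).
Variables (c N : nat) (mu : R).
Hypothesis c_gt0 : (0 < c)%N.
Hypothesis mu_gt0 : 0 < mu.
Hypothesis V_distr : forall g m B, measurable B ->
  distribution P (V g m) B = exponential_prob mu B.
Hypothesis q0_le_N : {ae P, forall w, (q0 w <= N)%N}.
Hypothesis a0_ge0 : {ae P, forall w, 0 <= a0 w}.
Hypothesis T_ge0 : forall j, {ae P, forall w, 0 <= T j w}.
Local Notation leb := (@lebesgue_measure R).
Local Notation W := (model q0 a0 T X V).

Let mW : measurable_world W := measurable_model q0 a0 T X V.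

Lemma measurable_model_fst :
  measurable_world (fun z : Omega * measurableTypeR R => W z.1).
Proof.
case: mW => h1 h2 h3 h4 h5.
split => [||j|j|g' m']; [exact: (measurableT_comp h1 measurable_fst)
    |exact: (measurableT_comp h2 measurable_fst)
    |exact: (measurableT_comp (h3 j) measurable_fst)
    |exact: (measurableT_comp (h4 j) measurable_fst)
    |exact: (measurableT_comp (h5 g' m') measurable_fst)].
Qed.

Lemma ae_service_gt0 : {ae P, forall w, forall g m, 0 < V g m w}.
Proof.
apply: ae_foralln => g; apply: ae_foralln => m; apply: ae_of_probability0.
  by apply: measurable_fun_ltr => //; exact: measurable_cst.
rewrite -[RHS](exponential_le0 (V_distr g m)).
by congr (P _); apply/seteqP; split => w /=; rewrite in_itv /= leNgt.
Qed.

(** The earlier departure time does not depend on the service time of the later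
    customer, so [compensator] applies to the event that t equals it, which has
    Lebesgue measure 0 as a set of times. *)
Lemma ae_distinct_departures g' m' g m : earlier (g', m') (g, m) ->
  {ae P, forall w, depart c N (W w) g' m' != depart c N (W w) g m}.
Proof.
move=> e.
(* The service time 0 stands for any value: the earlier departure does not
   depend on it, and F must not. *)
pose F (w : world R) (t : R) := t == depart c N (with_service w g m 0) g' m'.
have mF : measurable_along F.
  move=> d' S U t mU mt; apply: measurable_fun_eqr => //.
  apply: measurable_depart => //; case: mU => h1 h2 h3 h4 h5; split => //= g2 m2.
  by case: (_ == (g, m)) => //; exact: measurable_cst.
pose B (w : world R) := start c N w g m.
have mB d' (S : measurableType d') (U : S -> world R) : measurable_world U ->
    measurable_fun setT (fun x => B (U x)).
  by move=> mU; exact: measurable_start.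
have F_free w v t : F (with_service w g m v) t = F w t.
  by rewrite /F with_serviceK.
have B_free w v : B (with_service w g m v) = B w.
  by apply: with_service_start; rewrite /earlier /=; lia.
apply: ae_of_probability0.
  by apply: measurable_neg; apply: measurable_fun_eqr; exact: measurable_depart.
have -> : [set w | ~~ (depart c N (W w) g' m' != depart c N (W w) g m)] =
    [set w | F (W w) (B (W w) + V g m w)].
  by apply/seteqP; split => w /=; rewrite negbK /F with_service_depart// eq_sym.
apply: (etrans (compensator indep mu_gt0 V_distr mF mB F_free B_free)).
rewrite integral0_eq ?mule0// => w _.
set f := fun t => (B (W w) < t <= B (W w) + V g m w) && F (W w) t.
have mf : measurable_fun setT (f : measurableTypeR R -> bool).
  apply: measurable_and; first apply: measurable_and.
  - by apply: measurable_fun_ltr => //; exact: measurable_cst.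
  - by apply: measurable_fun_ler => //; exact: measurable_cst.
  - by apply: measurable_fun_eqr => //; exact: measurable_cst.
rewrite (integral_ind leb mf).
apply: (subset_measure0 _ _ _
  (lebesgue_measure_set1 (depart c N (with_service (W w) g m 0) g' m'))) => //.
  exact: (measurable_set_bool mf).
by move=> t /= /andP[_ /eqP].
Qed.

Lemma ae_good : {ae P, forall w, good c N (W w)}.
Proof.
have T0 := ae_foralln T_ge0.
have tie : {ae P, forall w, forall g' m' g m, earlier (g', m') (g, m) ->
    depart c N (W w) g' m' != depart c N (W w) g m}.
  apply: ae_foralln => g'; apply: ae_foralln => m'.
  apply: ae_foralln => g; apply: ae_foralln => m.
  have [e|ne] := boolP (earlier (g', m') (g, m)).
    by apply: filterS (ae_distinct_departures e) => w.
  by apply: aeW.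
by apply: filterS3 (filterI q0_le_N a0_ge0) (filterI T0 ae_service_gt0) tie
  => w [h1 h2] [h3 h4] h5; split.
Qed.

Definition downcrossing j n (w : Omega) : bool :=
  (n <= present (arrival (W w) j) (deps c N (W w) j.+1))%N &&
  (found_count c N (W w) j.+1 < n)%N.

Definition occupied j n (z : Omega * measurableTypeR R) : bool :=
  (arrival (W z.1) j < z.2 <= arrival (W z.1) j.+1) &&
  (presentc z.2 (deps c N (W z.1) j.+1) == n).

Lemma measurable_downcrossing j n : measurable_fun setT (downcrossing j n).
Proof.
apply: measurable_and.
  apply: (measurable_natrel leq); first exact: measurable_cst.
  by apply: measurable_present; [exact: measurable_arrival|exact: measurable_deps].
apply: (measurable_natrel (fun a b => (a < b)%N)); last exact: measurable_cst.
exact: measurable_found_count.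
Qed.

Lemma measurable_occupied j n : measurable_fun setT (occupied j n).
Proof.
have mW1 := measurable_model_fst.
apply: measurable_and; first apply: measurable_and.
- by apply: measurable_fun_ltr; [exact: measurable_arrival|exact: measurable_snd].
- by apply: measurable_fun_ler; [exact: measurable_snd|exact: measurable_arrival].
apply: (measurable_natrel (fun a b => a == b)); last exact: measurable_cst.
by apply: measurable_presentc; [exact: measurable_snd|exact: measurable_deps].
Qed.

Local Open Scope ereal_scope.

(** Each downcrossing is the departure of one customer; [compensator] turns the
    probability of each departure into an expected time in service, and at any
    time with n present the customers in service number min(n, c). *)
Lemma window_flow j n : (0 < n)%N ->
  P [set w | downcrossing j n w] =
  mu%:E * ((minn n c)%:R%:E * \int[P]_w \int[leb]_t ind (occupied j n (w, t))).
Proof.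
move=> n0; have mW1 := measurable_model_fst.
rewrite -integral_ind; last exact: measurable_downcrossing.
pose E (i : 'I_j.+2 * 'I_N) w :=
  departure_event c N i.1 i.2 j n (W w) (depart c N (W w) i.1 i.2).
pose K (i : 'I_j.+2 * 'I_N) (z : Omega * measurableTypeR R) :=
  (start c N (W z.1) i.1 i.2 < z.2 <= depart c N (W z.1) i.1 i.2)%R &&
      departure_event c N i.1 i.2 j n (W z.1) z.2.
have mE i : measurable_fun setT (E i).
  exact: (@measurable_departure_event _ c N c_gt0 i.1 i.2 j n _ _ _ _ mW
    (measurable_depart N c_gt0 mW i.1 i.2)).
have mK i : measurable_fun setT (K i).
  apply: measurable_and; first apply: measurable_and.
  - by apply: measurable_fun_ltr; [exact: measurable_start|exact: measurable_snd].
  - by apply: measurable_fun_ler; [exact: measurable_snd|exact: measurable_depart].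
  exact: (@measurable_departure_event _ c N c_gt0 i.1 i.2 j n _ _ _ _ mW1
    measurable_snd).
transitivity (\int[P]_w \sum_i ind (E i w)).
  apply: ge0_ae_eq_integral => //.
  - by apply: measurable_ind; exact: measurable_downcrossing.
  - by apply: emeasurable_sum => i; exact: measurable_ind.
  - by move=> w _; exact: ind_ge0.
  - by move=> w _; apply: sume_ge0 => i _; exact: ind_ge0.
  apply: filterS ae_good => w gw _.
  by rewrite /ind -sum_natE -(downcrossing_departures c_gt0 _ gw n0).
rewrite ge0_integral_sum//; last 2 first.
- by move=> i; exact: measurable_ind.
- by move=> i w _; exact: ind_ge0.
transitivity (\sum_i mu%:E * \int[P]_w \int[leb]_t ind (K i (w, t))).
  apply: eq_bigr => i _; rewrite integral_ind//.
  apply: (compensator indep mu_gt0 V_distr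
    (F := departure_event c N i.1 i.2 j n) (B := fun w => start c N w i.1 i.2)).
  - exact: measurable_departure_event.
  - by move=> d' S U mU; exact: measurable_start.
  - by move=> w v t; exact: departure_event_free.
  - by move=> w v; apply: with_service_start; rewrite /earlier /=; lia.
rewrite -ge0_sume_distrr; last first.
  by move=> i _; apply: integral_ge0 => w _; exact: time_integral_ge0.
congr (_ * _); rewrite -integral_sum_ind// -integral_scale_ind; last exact: measurable_occupied.
apply: ge0_ae_eq_integral => //.
- under eq_fun => w do under eq_integral => t _ do rewrite sum_natE.
  apply: (@measurable_fun_fubini_tonelli_F _ _ Omega (measurableTypeR R)
    R leb (fun z => \sum_i ind (K i z))).
    by apply: emeasurable_sum => i; exact: measurable_ind.
  by move=> z; apply: sume_ge0 => i _; exact: ind_ge0.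
- apply: (@measurable_fun_fubini_tonelli_F _ _ Omega (measurableTypeR R)
    R leb (fun z => (minn n c * occupied j n z)%N%:R%:E)).
    apply: (measurableT_comp (measurable_from_nat (fun k : nat => k%:R%:E : \bar R))).
    apply: (measurable_natop muln); first exact: measurable_cst.
    exact: (measurable_nat_of_bool (measurable_occupied j n)).
  by move=> z; rewrite lee_fin ler0n.
- by move=> w _; apply: integral_ge0 => t _; rewrite lee_fin ler0n.
- by move=> w _; apply: integral_ge0 => t _; rewrite lee_fin ler0n.
apply: filterS ae_good => w gw _; apply: eq_integral => t _.
by rewrite (in_service_window c_gt0 _ _ _ gw).
Qed.

End flow.

(** * The balance of upcrossings and downcrossings *)

Lemma sum_eq_ord n (f : nat) (e : nat -> bool) :
  (\sum_(k < n) ((f == k) && e k) = ((f < n) && e f)%N :> nat)%N.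
Proof.
have [fn|nf] := ltnP f n.
  rewrite (bigD1 (Ordinal fn))//= eqxx big1 ?addn0// => k /eqP kf.
  rewrite (_ : (f == k) = false)//; apply/negP => /eqP fk.
  by apply: kf; apply/val_inj; rewrite /= fk.
rewrite big1// => k _; rewrite (_ : (f == k) = false)//.
by apply/negP => /eqP fk; move: nf; rewrite fk leqNgt ltn_ord.
Qed.

Lemma sum_eq_ord1 n (f : nat) : (\sum_(k < n) (f == k) = (f < n)%N :> nat)%N.
Proof.
have := sum_eq_ord n f xpredT; rewrite andbT => <-.
by apply: eq_bigr => k _; rewrite andbT.
Qed.

Section batch_size_tail.
Context d (Omega : measurableType d) (R : realType) (P : probability Omega R).
Variables (X : {RV P >-> nat}) (b : nat -> R).
Hypothesis X_distr : forall k, P [set w | X w = k] = (b k)%:E.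

(** The event is the increasing union of the events m <= X < n. *)
Lemma batch_tailE m : P [set w | (m <= X w)%N] = (batch_tail b m)%:E.
Proof.
have mX (Y : set nat) : measurable [set w | Y (X w)].
  by rewrite -[X in measurable X]setTI; exact: (measurable_funPT X).
pose F n := [set w | (m <= X w < n)%N].
have FE n : P (F n) = (\sum_(m <= i < n) b i)%:E.
  elim: n => [|n IH].
    rewrite big_geq// (_ : F 0%N = set0) ?measure0//.
    by apply/seteqP; split => w //=; rewrite /F /=; lia.
  have [mn|nm] := leqP m n; last first.
    rewrite big_geq// (_ : F n.+1 = set0) ?measure0//.
    by apply/seteqP; split => w //=; rewrite /F /=; lia.
  rewrite big_nat_recr//= EFinD -IH -X_distr -measureU//.
  - by congr (P _); apply/seteqP; split => w; rewrite /F /=; lia.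
  - exact: (mX (fun k => (m <= k < n)%N)).
  - exact: (mX (fun k => k = n)).
  - by apply/seteqP; split => w //; rewrite /F /=; lia.
have cF : P (F n) @[n --> \oo] --> P (\bigcup_n F n).
  apply: nondecreasing_cvg_mu => [n||n n' nn].
  - exact: (mX (fun k => (m <= k < n)%N)).
  - by apply: bigcupT_measurable => n; exact: (mX (fun k => (m <= k < n)%N)).
  - by apply/subsetPset => w; rewrite /F /=; lia.
have UF : \bigcup_n F n = [set w | (m <= X w)%N].
  apply/seteqP; split => w; first by move=> [n _]; rewrite /F /=; lia.
  by move=> /= mw; exists (X w).+1 => //; rewrite /F /=; lia.
have fP : P (\bigcup_n F n) \is a fin_num.
  apply: fin_num_measure; apply: bigcupT_measurable => n.
  exact: (mX (fun k => (m <= k < n)%N)).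
rewrite -UF -(fineK fP); congr EFin; apply/esym/cvg_lim => //.
rewrite -(fineK fP) in cF; move/fine_cvg : cF.
rewrite (_ : fine \o _ = (fun n => \sum_(m <= i < n) b i)%R)//.
by apply/funext => n /=; rewrite FE.
Qed.

End batch_size_tail.

Section rate_balance.
Context d (Omega : measurableType d) (R : realType) (P : probability Omega R).
Variables (q0 : {RV P >-> nat}) (a0 : {RV P >-> R}).
Variables (T : nat -> {RV P >-> R}) (X : nat -> {RV P >-> nat}).
Variable V : nat -> nat -> {RV P >-> R}.
Hypothesis indep : mutually_independent P (source_events q0 a0 T X V).
Variables (c N : nat) (mu : R).
Hypothesis c_gt0 : (0 < c)%N.
Hypothesis mu_gt0 : 0 < mu.
Hypothesis V_distr : forall g m B, measurable B ->
  distribution P (V g m) B = exponential_prob mu B.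
Hypothesis q0_le_N : {ae P, forall w, (q0 w <= N)%N}.
Hypothesis a0_ge0 : {ae P, forall w, 0 <= a0 w}.
Hypothesis T_ge0 : forall j, {ae P, forall w, 0 <= T j w}.
Local Notation leb := (@lebesgue_measure R).
Local Notation W := (model q0 a0 T X V).
Let mW : measurable_world W := measurable_model q0 a0 T X V.
Local Open Scope ereal_scope.

Definition occupied_until J n (z : Omega * measurableTypeR R) : bool :=
  (arrival (W z.1) 0 < z.2 <= arrival (W z.1) J)%R &&
  (state c N (W z.1) z.2 == n).

Lemma measurable_occupied_until J n : measurable_fun setT (occupied_until J n).
Proof.
have mW1 := measurable_model_fst q0 a0 T X V.
apply: measurable_and; first apply: measurable_and.
- by apply: measurable_fun_ltr; [exact: measurable_arrival|exact: measurable_snd].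
- by apply: measurable_fun_ler; [exact: measurable_snd|exact: measurable_arrival].
apply: (measurable_natrel (fun a b => a == b)); last exact: measurable_cst.
exact: (measurable_state N c_gt0 mW1 measurable_snd).
Qed.

Lemma countable_seq (s : seq R) : cardinality.countable [set` s].
Proof. by apply: finite_set_countable; exact: finite_seq. Qed.

Lemma lebesgue_measure_seq (s : seq R) : leb [set` s] = 0.
Proof. exact: countable_lebesgue_measure0 (countable_seq s). Qed.

Lemma integral_off_seq (s : seq R) (f g : R -> \bar R) :
  measurable_fun setT f -> measurable_fun setT g ->
  (forall t, 0 <= f t) -> (forall t, 0 <= g t) ->
  (forall t, t \notin s -> f t = g t) ->
  \int[leb]_t f t = \int[leb]_t g t.
Proof.
move=> mf mg f0 g0 fg; apply: ge0_ae_eq_integral => //.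
exists [set` s]; split.
- by apply: countable_measurable => //; exact: countable_seq.
- exact: lebesgue_measure_seq.
- move=> t /= nt; apply: contra_notP nt => /negP ts _; exact: fg.
Qed.

(** The windows between arrivals 0 and J add up to a single time interval, on
    which the list of departures may be replaced by the state. *)
Lemma total_flow J n : (0 < n)%N ->
  \sum_(j < J) P [set w | downcrossing q0 a0 T X V c N j n w] =
  mu%:E * ((minn n c)%:R%:E *
    \int[P]_w \int[leb]_t ind (occupied_until J n (w, t))).
Proof.
move=> n0.
under eq_bigr => j _ do rewrite (window_flow indep c_gt0 mu_gt0 V_distr q0_le_N a0_ge0 T_ge0)//.
have mocc (j : 'I_J) := measurable_occupied q0 a0 T X V N c_gt0 j n.
have I0 (j : 'I_J) : 0 <= \int[P]_w \int[leb]_t ind (occupied q0 a0 T X V c N j n (w, t)).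
  by apply: integral_ge0 => w _; exact: time_integral_ge0.
rewrite -ge0_sume_distrr; last by move=> j _; rewrite mule_ge0.
rewrite -ge0_sume_distrr//; congr (_ * (_ * _)).
rewrite -(integral_sum_ind P mocc).
apply: ge0_ae_eq_integral => //.
- under eq_fun => w do under eq_integral => t _ do rewrite sum_natE.
  apply: (@measurable_fun_fubini_tonelli_F _ _ Omega (measurableTypeR R)
    R leb (fun z => \sum_(j < J) ind (occupied q0 a0 T X V c N j n z))).
    by apply: emeasurable_sum => j; exact: measurable_ind.
  by move=> z; apply: sume_ge0 => i _; exact: ind_ge0.
- exact: (measurable_time_integral (measurable_occupied_until J n)).
- by move=> w _; apply: integral_ge0 => t _; rewrite lee_fin ler0n.
- by move=> w _; exact: time_integral_ge0.
apply: filterS (ae_good indep c_gt0 mu_gt0 V_distr q0_le_N a0_ge0 T_ge0) => w gw _.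
have [_ a00 ga _ _] := gw.
apply: (integral_off_seq (s := [seq arrival (W w) j | j <- iota 0 J.+1] ++
   flatten [seq deps c N (W w) j.+1 | j <- iota 0 J])).
- under eq_fun => t do rewrite sum_natE.
  apply: emeasurable_sum => j; exact: (measurable_ind (measurable_time_slice w (mocc j))).
- exact: (measurable_ind (measurable_time_slice w (measurable_occupied_until J n))).
- by move=> t; rewrite lee_fin ler0n.
- by move=> t; exact: ind_ge0.
move=> t; rewrite mem_cat negb_or => /andP[/mapP t1 /flatten_mapP t2].
rewrite /ind /occupied_until /= -(window_sum a00)// => j jJ.
  apply/eqP => tj; apply: t1; exists j => //.
  by rewrite mem_iota; lia.
apply/negP => tj; apply: t2; exists j => //.
by rewrite mem_iota; lia.
Qed.

(** Let K be the number present just after arrival j. Neither [found_count]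
    before nor after exceeds K, so the indicators satisfy 1(found_(j+1) < n <=
    K) + 1(found_j < n) = 1(found_(j+1) < n) + 1(found_j < n <= K); terms are
    placed so that none is subtracted. For n <= N, a batch that finds k < n
    customers brings the number to n or more exactly when its size is at least
    n - k, although it may be rejected in part. *)
Lemma crossing_balance j n : (0 < n)%N -> (n <= N)%N ->
  {ae P, forall w, (downcrossing q0 a0 T X V c N j n w +
     \sum_(k < n) (found_count c N (W w) j == k) =
     \sum_(k < n) (found_count c N (W w) j.+1 == k) +
     \sum_(k < n) ((found_count c N (W w) j == k) && (n - k <= X j w)))%N}.
Proof.
move=> n0 nN; apply: filterS (ae_good indep c_gt0 mu_gt0 V_distr q0_le_N a0_ge0 T_ge0).
move=> w [_ a00 ga V0 _].
rewrite !sum_eq_ord1 (sum_eq_ord _ _ (fun k => n - k <= X j w)%N).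
rewrite /downcrossing (present_after_arrival c N (V0 j.+1)) /=.
have : (found_count c N (W w) j.+1 <= present (arrival (W w) j) (deps c N (W w) j.+1))%N.
  by apply: present_le; exact: arrival_le.
rewrite (present_after_arrival c N (V0 j.+1)) /=.
move: (found_count _ _ _ _) (found_count _ _ _ _) (X j w) => f1 f0 x.
lia.
Qed.

Variable b : nat -> R.
Hypothesis X_distr : forall j k, P [set w | X j w = k] = (b k)%:E.

(** What batch j finds depends on the earlier batches only, as replacing its
    size by 0 shows. *)
Lemma found_batch_indep j k m :
  P [set w | (found_count c N (W w) j == k) && (m <= X j w)%N] =
  P [set w | found_count c N (W w) j = k] * (batch_tail b m)%:E.
Proof.
rewrite -(batch_tailE (X_distr j) m).
rewrite -(others_indep (source_setT q0 a0 T X V) (@source_setI _ _ _ _ q0 a0 T X V)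
  (@source_measurable _ _ _ _ q0 a0 T X V) indep (i0 := BatchSize j)).
- by congr (P _); apply/seteqP; split => w /= => [/andP[/eqP]|[-> ->]]//; rewrite eqxx.
- have -> : [set w | found_count c N (W w) j = k] =
      [set w | found_count c N (with_batch (W w) j 0) j = k].
    have e w : found_count c N (with_batch (W w) j 0) j = found_count c N (W w) j.
      apply: found_count_congr => //= i ij; rewrite ifN//.
      by apply/eqP => ij2; rewrite ij2 ltnn in ij.
    by apply/seteqP; split => w /=; rewrite e.
  exact: (measurable_set_nat k
    (measurable_found_count N c_gt0 (measurable_with_batch q0 a0 T X V j 0) j)).
- by exists [set x | (m <= x)%N] => //; rewrite setTI.
Qed.

Lemma probability_balance j n : (0 < n)%N -> (n <= N)%N ->
  P [set w | downcrossing q0 a0 T X V c N j n w] +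
  \sum_(k < n) P [set w | found_count c N (W w) j = k] =
  \sum_(k < n) P [set w | found_count c N (W w) j.+1 = k] +
  \sum_(k < n) P [set w | found_count c N (W w) j = k] * (batch_tail b (n - k))%:E.
Proof.
move=> n0 nN.
have mD := measurable_downcrossing q0 a0 T X V N c_gt0 j n.
have mf i k : measurable_fun setT (fun w => found_count c N (W w) i == k).
  apply: (measurable_natrel (fun a b => a == b)); last exact: measurable_cst.
  exact: measurable_found_count.
have mC k : measurable_fun setT (fun w =>
    (found_count c N (W w) j == k) && (n - k <= X j w)%N).
  apply: measurable_and => //.
  exact: (measurable_natrel leq (f := fun=> (n - k)%N) (g := X j)).
have fE i k : P [set w | found_count c N (W w) i = k] =
    \int[P]_w ind (found_count c N (W w) i == k).
  rewrite integral_ind//; congr (P _).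
  by apply/seteqP; split => w /= /eqP.
under eq_bigr do rewrite fE.
under [X in _ = X + _]eq_bigr do rewrite fE.
under [X in _ = _ + X]eq_bigr => k _ do
  rewrite -found_batch_indep -(integral_ind P (mC k)).
rewrite -(integral_ind P mD).
have sE (g : 'I_n -> Omega -> bool) : (forall k, measurable_fun setT (g k)) ->
    \sum_k \int[P]_w ind (g k w) = \int[P]_w \sum_k ind (g k w).
  move=> mg; rewrite ge0_integral_sum//; first by move=> k; exact: measurable_ind.
  by move=> k w _; exact: ind_ge0.
have mS (g : 'I_n -> Omega -> bool) : (forall k, measurable_fun setT (g k)) ->
    measurable_fun setT (fun w => \sum_k (ind (g k w) : \bar R)).
  by move=> mg; apply: emeasurable_sum => k; exact: measurable_ind.
have mf' i := fun k : 'I_n => mf i k.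
have mC' := fun k : 'I_n => mC k.
rewrite (sE _ (mf' j)) (sE _ (mf' j.+1)) (sE _ mC').
rewrite -!ge0_integralD//; try exact: mS; try exact: measurable_ind;
  try (by move=> w _; exact: ind_ge0);
  try by move=> w _; apply: sume_ge0 => k _; exact: ind_ge0.
apply: ge0_ae_eq_integral => //.
- by apply: emeasurable_funD; [exact: measurable_ind|exact: mS].
- by apply: emeasurable_funD; exact: mS.
- move=> w _; apply: adde_ge0; first exact: ind_ge0.
  by apply: sume_ge0 => k _; exact: ind_ge0.
- by move=> w _; apply: adde_ge0; apply: sume_ge0 => k _; exact: ind_ge0.
apply: filterS (crossing_balance j n0 nN) => w e _.
by rewrite /ind -!sum_natE -!EFinD -!natrD e.
Qed.

End rate_balance.

(** * A law of large numbers in the mean for the arrival times *)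

Section expectations.
Context d (Omega : measurableType d) (R : realType) (P : probability Omega R).
Implicit Types f g : Omega -> R.
Local Open Scope ereal_scope.

Lemma mean_add f g : measurable_fun setT f -> measurable_fun setT g ->
  (forall w, 0 <= f w)%R -> (forall w, 0 <= g w)%R ->
  \int[P]_w (f w + g w)%:E = \int[P]_w (f w)%:E + \int[P]_w (g w)%:E.
Proof.
move=> mf mg f0 g0; rewrite -ge0_integralD//.
- by move=> w _; rewrite lee_fin.
- exact/measurable_EFinP.
- by move=> w _; rewrite lee_fin.
- exact/measurable_EFinP.
Qed.

Lemma mean_scale (k : R) f : measurable_fun setT f ->
  (forall w, 0 <= f w)%R -> (0 <= k)%R ->
  \int[P]_w (k * f w)%:E = k%:E * \int[P]_w (f w)%:E.
Proof.
move=> mf f0 k0; rewrite -ge0_integralZl//.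
- exact/measurable_EFinP.
- by move=> w _; rewrite lee_fin.
Qed.

Lemma mean_cst (k : R) : \int[P]_w k%:E = k%:E.
Proof.
transitivity (k%:E * P setT); last by rewrite probability_setT mule1.
exact: (integral_cst P measurableT k%:E).
Qed.

Lemma mean_le f g : measurable_fun setT f -> measurable_fun setT g ->
  (forall w, 0 <= f w)%R -> (forall w, f w <= g w)%R ->
  \int[P]_w (f w)%:E <= \int[P]_w (g w)%:E.
Proof.
move=> mf mg f0 fg; apply: ge0_le_integral => //.
- by move=> w _; rewrite lee_fin.
- exact/measurable_EFinP.
- exact/measurable_EFinP.
- by move=> w _; rewrite lee_fin.
Qed.

End expectations.

(** The half-lines (x, oo) form a pi-system that generates the Borel sets. *)
Lemma eq_cdf_distribution d (Omega : measurableType d) (R : realType)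
    (P : probability Omega R) (X Y : {RV P >-> R}) :
  (forall t, cdf X t = cdf Y t) ->
  forall B, measurable B -> distribution P X B = distribution P Y B.
Proof.
move=> XY; pose g (n : nat) : set R := `]- n%:R, +oo[%classic.
move=> B mB.
apply: (@measure_unique _ R R (@RGenOInfty.G R) g _ _ _ _
  (distribution P X) (distribution P Y) _ _ B mB).
- exact: RGenOInfty.measurableE.
- move=> _ _ [x ->] [y ->]; exists (Num.max x y).
  by apply/seteqP; split => z /=; rewrite !in_itv /= !andbT gt_max => /andP.
- by move=> n; exists (- n%:R).
- apply/seteqP; split => // x _; exists (Num.truncn `|x|).+1 => //.
  rewrite /g /= in_itv /= andbT ltrNl.
  by rewrite (le_lt_trans _ (truncnS_gt _))// ler_normr lexx orbT.
- by move=> _ [x ->]; have := ccdf_1_cdf X x; rewrite XY -ccdf_1_cdf.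
- move=> n; apply: (@le_lt_trans _ _ 1%E); last exact: ltry.
  by apply: probability_le1; exact: measurable_itv.
Qed.

Section law_of_large_numbers.
Context d (Omega : measurableType d) (R : realType) (P : probability Omega R).
Variables (q0 : {RV P >-> nat}) (a0 : {RV P >-> R}).
Variables (T : nat -> {RV P >-> R}) (X : nat -> {RV P >-> nat}).
Variable V : nat -> nat -> {RV P >-> R}.
Hypothesis indep : mutually_independent P (source_events q0 a0 T X V).
Variable m : R.
Hypothesis T_ge0 : forall j, {ae P, forall w, 0 <= T j w}.
Hypothesis T_distr : forall i j t, cdf (T i) t = cdf (T j) t.
Hypothesis T_mean : forall j, ('E_P[T j] = m%:E)%E.
Local Open Scope ereal_scope.

(** Truncation to [0, K]. The interarrival times have a first moment only, and
    their truncations have second moments. *)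
Definition clip (K x : R) : R := (Num.min K (Num.max 0 x))%R.

Lemma measurable_clip K : measurable_fun setT (clip K).
Proof.
by apply: measurable_minr; [exact: measurable_cst|apply: measurable_maxr].
Qed.

Lemma clip_ge0 K x : (0 <= K -> 0 <= clip K x)%R.
Proof. by move=> K0; rewrite /clip le_min K0 le_max lexx. Qed.

Lemma clip_le K x : (clip K x <= K)%R.
Proof. by rewrite /clip ge_min lexx. Qed.

Let mT j : measurable_fun setT (T j). Proof. by []. Qed.

Let mclip K j : measurable_fun setT (fun w => clip K (T j w)).
Proof. exact: (measurableT_comp (measurable_clip K) (mT j)). Qed.

Definition clipped_mean K : R := fine (\int[P]_w (clip K (T 0%N w))%:E).

Section clipped.
Variable K : R.
Hypothesis K_ge0 : (0 <= K)%R.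
Local Notation y := (clipped_mean K).
Local Notation S J := (fun w => (\sum_(j < J) clip K (T j w))%R).

Lemma mean_clip j : \int[P]_w (clip K (T j w))%:E = y%:E.
Proof.
have e i : \int[P]_w (clip K (T i w))%:E = \int[distribution P (T i)]_x (clip K x)%:E.
  rewrite ge0_integral_distribution//.
    by apply/measurable_EFinP; exact: measurable_clip.
  by move=> x; rewrite lee_fin clip_ge0.
rewrite /clipped_mean fineK.
  rewrite !e; apply: eq_measure_integral => B mB _.
  exact: eq_cdf_distribution.
rewrite ge0_fin_numE; last by apply: integral_ge0 => w _; rewrite lee_fin clip_ge0.
apply: (@le_lt_trans _ _ (\int[P]_w K%:E)); last by rewrite mean_cst ltry.
by apply: mean_le => // w; [exact: clip_ge0|exact: clip_le].
Qed.

Lemma clipped_mean_ge0 : (0 <= y)%R.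
Proof.
rewrite -lee_fin -(mean_clip 0); apply: integral_ge0 => w _.
by rewrite lee_fin clip_ge0.
Qed.

Let mS J : measurable_fun setT (S J).
Proof. exact: measurable_sum. Qed.

Let S_ge0 J w : (0 <= S J w)%R.
Proof. by apply: sumr_ge0 => j _; exact: clip_ge0. Qed.

Lemma mean_clipped_sum J : \int[P]_w (S J w)%:E = (J%:R * y)%:E.
Proof.
elim: J => [|J IH].
  under eq_integral do rewrite big_ord0.
  by rewrite mean_cst mul0r.
under eq_integral do rewrite big_ord_recr /=.
rewrite (mean_add P (mS J) (mclip K J))// => [|w]; last exact: clip_ge0.
by rewrite IH mean_clip -EFinD -[in RHS]natr1 mulrDl mul1r.
Qed.

(** Resampling T J replaces its truncation by the mean, because the sum of the
    preceding ones does not involve T J. *)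
Lemma mean_clipped_product J :
  \int[P]_w (S J w * clip K (T J w))%:E = (J%:R * y * y)%:E.
Proof.
have resample := ge0_integral_resample (source_setT q0 a0 T X V)
  (@source_setI _ _ _ _ q0 a0 T X V) (@source_measurable _ _ _ _ q0 a0 T X V)
  indep (i0 := Interarrival J) (Y := T J) (@subset_refl _ _).
set Omega0 := g_sigma_algebraType (others (source_events q0 a0 T X V)
  (Interarrival J)).
pose f (z : Omega0 * R) : \bar R := (S J z.1 * clip K z.2)%:E.
have mS0 : measurable_fun setT (S J : Omega0 -> R).
  apply: measurable_sum => j; apply: (measurableT_comp (measurable_clip K)).
  apply: others_gap; apply/eqP => -[jJ].
  by have := ltn_ord j; rewrite jJ ltnn.
have mf : measurable_fun setT f.
  apply/measurable_EFinP; apply: measurable_funM.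
    exact: (measurableT_comp mS0 measurable_fst).
  exact: (measurableT_comp (measurable_clip K) measurable_snd).
rewrite (resample f mf); last by move=> z; rewrite lee_fin; apply: mulr_ge0; [exact: S_ge0|exact: clip_ge0].
transitivity (\int[P]_w (y * S J w)%:E).
  apply: eq_integral => w _; rewrite /f /=.
  rewrite ge0_integral_distribution//; last 2 first.
  - apply/measurable_EFinP; apply: measurable_funM => //; exact: measurable_clip.
  - by move=> x; rewrite lee_fin; apply: mulr_ge0; [exact: S_ge0|exact: clip_ge0].
  rewrite /= mean_scale//; [|by move=> w'; exact: clip_ge0|exact: S_ge0].
  by rewrite mean_clip -EFinM mulrC.
rewrite mean_scale//; last exact: clipped_mean_ge0.
by rewrite mean_clipped_sum -EFinM mulrC.
Qed.

Lemma second_moment J :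
  \int[P]_w ((S J w) ^+ 2)%:E <= (J%:R * K ^+ 2 + J%:R ^+ 2 * y ^+ 2)%:E.
Proof.
elim: J => [|J IH].
  under eq_integral do rewrite big_ord0 expr2 mulr0.
  by rewrite mean_cst lee_fin !mul0r add0r expr2 !mul0r.
have e w : ((S J.+1 w) ^+ 2 = (S J w) ^+ 2 +
    (2 * (S J w * clip K (T J w)) + clip K (T J w) ^+ 2))%R.
  by rewrite big_ord_recr /=; ring.
under eq_integral do rewrite e.
have mSc : measurable_fun setT (fun w => S J w * clip K (T J w))%R.
  exact: measurable_funM.
have Sc0 w : (0 <= S J w * clip K (T J w))%R by apply: mulr_ge0; [exact: S_ge0|exact: clip_ge0].
rewrite mean_add; last 4 first.
- exact: measurable_funX.
- apply: measurable_funD; last exact: measurable_funX.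
  exact: measurable_funM.
- by move=> w; exact: sqr_ge0.
- by move=> w; rewrite addr_ge0 ?sqr_ge0// mulr_ge0.
rewrite mean_add; last 4 first.
- exact: measurable_funM.
- exact: measurable_funX.
- by move=> w; rewrite mulr_ge0.
- by move=> w; exact: sqr_ge0.
rewrite mean_scale// mean_clipped_product.
apply: (@le_trans _ _ ((J%:R * K ^+ 2 + J%:R ^+ 2 * y ^+ 2)%:E +
  (2%:E * (J%:R * y * y)%:E + (K ^+ 2)%:E))).
  apply: leeD => //; apply: leeD => //.
  rewrite -[leRHS](mean_cst P); apply: mean_le => //.
  - exact: measurable_funX.
  - by move=> w; exact: sqr_ge0.
  - by move=> w; rewrite ler_sqr ?nnegrE// ?clip_ge0// clip_le.
rewrite -EFinM -!EFinD lee_fin -natr1.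
have : (0 <= y ^+ 2)%R by exact: sqr_ge0.
nra.
Qed.

(** With a the sum and b its mean, |a - b| <= h / 2 + (a - b) ^ 2 / (2 h). The
    cross term of the square is moved to the left-hand side, so that only
    nonnegative functions are integrated; after taking means, the two terms in
    y ^ 2 cancel. *)
Lemma clipped_deviation J h : (0 < h)%R ->
  \int[P]_w (`|S J w - J%:R * y|)%:E <= (h / 2 + J%:R * K ^+ 2 / (2 * h))%:E.
Proof.
move=> h0; set b := (J%:R * y)%R.
have b0 : (0 <= b)%R by rewrite mulr_ge0// clipped_mean_ge0.
have point w : (`|S J w - b| + (b / h) * S J w <=
    (h / 2 + b ^+ 2 / (2 * h)) + (2 * h)^-1 * (S J w) ^+ 2)%R.
  move: (S J w) (S_ge0 J w) => a a_ge0.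
  rewrite -(ler_pM2r (_ : 0 < 2 * h)%R) ?mulr_gt0//.
  have -> : ((`|a - b| + b / h * a) * (2 * h) = 2 * h * `|a - b| + 2 * a * b)%R.
    by field; rewrite gt_eqF.
  have -> : ((h / 2 + b ^+ 2 / (2 * h) + (2 * h)^-1 * a ^+ 2) * (2 * h) =
      h ^+ 2 + b ^+ 2 + a ^+ 2)%R by field; rewrite gt_eqF.
  have : (0 <= (`|a - b| - h) ^+ 2)%R by exact: sqr_ge0.
  by rewrite sqrrB real_normK ?num_real//; lra.
have mdev : measurable_fun setT (fun w => `|S J w - b|)%R.
  by apply: measurableT_comp => //; apply: measurable_funB.
have := @mean_le _ _ _ P (fun w => `|S J w - b| + (b / h) * S J w)%R
  (fun w => (h / 2 + b ^+ 2 / (2 * h)) + (2 * h)^-1 * (S J w) ^+ 2)%R.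
have bh0 : (0 <= b / h)%R by rewrite divr_ge0// ltW.
have c0 : (0 <= h / 2 + b ^+ 2 / (2 * h))%R.
  by rewrite addr_ge0// divr_ge0 ?sqr_ge0// ?mulr_ge0// ltW.
have h20 : (0 <= (2 * h)^-1)%R by rewrite invr_ge0 mulr_ge0// ltW.
rewrite mean_add//; last 2 first.
- exact: measurable_funM.
- by move=> w; rewrite mulr_ge0.
rewrite mean_scale// mean_clipped_sum mean_add//; last 2 first.
- by apply: measurable_funM => //; exact: measurable_funX.
- by move=> w; rewrite mulr_ge0 ?sqr_ge0.
rewrite mean_cst mean_scale//; last 2 first.
- exact: measurable_funX.
- by move=> w; exact: sqr_ge0.
move=> H.
have {}H : \int[P]_w `|S J w - b|%:E + ((b / h)%:E * (J%:R * y)%:E) <=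
    (h / 2 + b ^+ 2 / (2 * h))%:E + (2 * h)^-1%:E * (J%:R * K ^+ 2 + J%:R ^+ 2 * y ^+ 2)%:E.
  apply: le_trans (H _ _ _ _) _ => //.
  - by apply: measurable_funD => //; exact: measurable_funM.
  - by apply: measurable_funD => //; apply: measurable_funM => //; exact: measurable_funX.
  - by move=> w; rewrite addr_ge0// mulr_ge0.
  - by rewrite leeD2l// lee_wpmul2l// second_moment.
move: H; rewrite -!EFinM -EFinD -leeBrDr// -EFinB => /le_trans; apply.
rewrite lee_fin le_eqVlt; apply/orP; left; apply/eqP.
by rewrite /b; field; rewrite gt_eqF.
Qed.

End clipped.

Let pos j w := Num.max 0%R (T j w).

Let mpos j : measurable_fun setT (pos j).
Proof. exact: measurable_maxr. Qed.

Let pos_ge0 j w : (0 <= pos j w)%R.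
Proof. by rewrite le_max lexx. Qed.

Let mean_pos j : \int[P]_w (pos j w)%:E = m%:E.
Proof.
rewrite -(T_mean j) expectation_def; apply: ae_eq_integral => //.
- exact/measurable_EFinP.
- exact/measurable_EFinP.
by apply: filterS (T_ge0 j) => w Tw _; rewrite /pos max_r.
Qed.

(** Monotone convergence. *)
Lemma clipped_mean_cvg : clipped_mean n%:R @[n --> \oo] --> m.
Proof.
pose g n w := (clip n%:R (T 0%N w))%:E.
have -> : (fun n : nat => clipped_mean n%:R) = fine \o (fun n => \int[P]_w g n w).
  by apply/funext => n /=; rewrite /g mean_clip.
apply: fine_cvg; rewrite -(mean_pos 0).
have -> : \int[P]_w (pos 0 w)%:E = \int[P]_w limn (g^~ w).
  apply: eq_integral => w _; apply/esym/cvg_lim => //.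
  apply: cvg_near_cst; near=> n; rewrite /g /clip min_r//.
  by near: n; exact: nbhs_infty_ger.
apply: cvg_monotone_convergence => //.
- by move=> n; exact/measurable_EFinP.
- by move=> n w _; rewrite lee_fin clip_ge0.
- move=> w _ n n' nn; rewrite lee_fin /clip.
  by rewrite le_min !ge_min lexx ler_nat nn/= orbT.
Unshelve. all: by end_near.
Qed.

Lemma clipped_mean_le K : (0 <= K)%R -> (clipped_mean K <= m)%R.
Proof.
move=> K0; rewrite -lee_fin -(mean_clip K0 0) -(mean_pos 0).
by apply: mean_le => // w; [exact: clip_ge0|rewrite /clip ge_min lexx orbT].
Qed.

(** Truncate at a level K for which the truncated mean is within e / 8 of m.
    The truncation costs at most twice J e / 8 in mean, and the deviation of
    the truncated sum is bounded by [clipped_deviation] with h = e J / 2, which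
    leaves e J / 4 and the constant K ^ 2 / e. *)
Lemma weak_law (e : R) : (0 < e)%R -> exists J0, forall J, (J0 <= J)%N ->
  \int[P]_w (`|\sum_(j < J) T j w - J%:R * m|)%:E <= (e * J%:R)%:E.
Proof.
move=> e0.
have e8 : (0 < e / 8)%R by rewrite divr_gt0.
have /cvgrPdist_le/(_ _ e8) [n0 _ /(_ n0 (leqnn _)) yn0] := clipped_mean_cvg.
set K : R := n0%:R in yn0; have K0 : (0 <= K)%R by rewrite ler0n.
set y := clipped_mean K in yn0.
have ym : (y <= m)%R := clipped_mean_le K0.
have {}yn0 : (m - y <= e / 8)%R by rewrite (le_trans _ yn0)// ler_norm.
(* From here on K ^ 2 / e is at most e J / 2. *)
exists (Num.truncn (2 * K ^+ 2 / e ^+ 2)).+1 => J JJ.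
have J1 : (2 * K ^+ 2 / e ^+ 2 <= J%:R)%R.
  by apply/ltW/(lt_le_trans (truncnS_gt _)); rewrite ler_nat.
have J0 : (0 < J%:R :> R)%R by rewrite ltr0n; exact: leq_ltn_trans JJ.
pose S w := (\sum_(j < J) clip K (T j w))%R.
pose D w := `|\sum_(j < J) T j w - J%:R * m|%R.
have mS : measurable_fun setT S by exact: measurable_sum.
have S0 w : (0 <= S w)%R by apply: sumr_ge0 => j _; exact: clip_ge0.
have D0 w : (0 <= D w)%R by rewrite /D normr_ge0.
have mD : measurable_fun setT D.
  by apply: measurableT_comp => //; apply: measurable_funB => //; exact: measurable_sum.
have mdev : measurable_fun setT (fun w => `|S w - J%:R * y|)%R.
  by apply: measurableT_comp => //; apply: measurable_funB.
pose Q w := (\sum_(j < J) pos j w)%R.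
have mQ : measurable_fun setT Q by exact: measurable_sum.
have Q0 w : (0 <= Q w)%R by apply: sumr_ge0.
have meanQ : \int[P]_w (Q w)%:E = (J%:R * m)%:E.
  under eq_integral do rewrite /Q -sumEFin.
  rewrite ge0_integral_sum//; last 2 first.
  - by move=> j; exact/measurable_EFinP.
  - by move=> j w _; rewrite lee_fin.
  under eq_bigr do rewrite mean_pos.
  by rewrite sumEFin sumr_const card_ord mulr_natl.
have Jmy0 : (0 <= J%:R * (m - y))%R by rewrite mulr_ge0// subr_ge0.
have : \int[P]_w (D w + S w)%:E <=
    \int[P]_w (Q w + (`|S w - J%:R * y| + J%:R * (m - y)))%:E.
  apply: ae_ge0_le_integral => //.
  - by move=> w _; rewrite lee_fin; apply: addr_ge0.
  - by apply/measurable_EFinP; exact: measurable_funD.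
  - by move=> w _; rewrite lee_fin; apply: addr_ge0 => //; apply: addr_ge0.
  - apply/measurable_EFinP; apply: measurable_funD => //.
    exact: (measurable_funD mdev (measurable_cst _)).
  apply: filterS (ae_foralln T_ge0) => w Tw _; rewrite lee_fin.
  have -> : Q w = (\sum_(j < J) T j w)%R.
    by apply: eq_bigr => j _; rewrite /pos max_r.
  have ST : (S w <= \sum_(j < J) T j w)%R.
    apply: ler_sum => j _; rewrite /clip ge_min; apply/orP; right.
    by rewrite max_r.
  rewrite /D; move: (\sum_(j < J) T j w)%R (S w) ST => q s sq.
  have := ler_normD (q - s)%R (s - J%:R * y + (J%:R * y - J%:R * m))%R.
  have := ler_normD (s - J%:R * y)%R (J%:R * y - J%:R * m)%R.
  have -> : (`|J%:R * y - J%:R * m| = J%:R * (m - y))%R.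
    by rewrite -mulrBr -opprB mulrN normrN ger0_norm.
  have -> : (`|q - s| = q - s)%R by rewrite ger0_norm// subr_ge0.
  have -> : (q - s + (s - J%:R * y + (J%:R * y - J%:R * m)) = q - J%:R * m)%R by ring.
  lra.
rewrite mean_add// (mean_clipped_sum K0) mean_add//; last 2 first.
- exact: measurable_funD.
- by move=> w; rewrite addr_ge0.
rewrite mean_add// mean_cst meanQ.
set h := (e / 2 * J%:R)%R.
have h0 : (0 < h)%R by rewrite mulr_gt0// divr_gt0.
move=> H.
have {}H : \int[P]_w (D w)%:E + (J%:R * y)%:E <= (J%:R * m)%:E +
    ((h / 2 + J%:R * K ^+ 2 / (2 * h))%:E + (J%:R * (m - y))%:E).
  by apply: (le_trans H); rewrite leeD2l// leeD2r// clipped_deviation.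
move: H; rewrite -!EFinD -leeBrDr// -EFinB => /le_trans; apply.
rewrite lee_fin.
have -> : (J%:R * K ^+ 2 / (2 * h) = K ^+ 2 / e)%R.
  by rewrite /h; field; rewrite !gt_eqF.
have : (K ^+ 2 / e <= e * J%:R / 2)%R.
  rewrite ler_pdivrMr//.
  move: J1; rewrite ler_pdivrMr ?exprn_gt0//.
  rewrite expr2; nra.
have : (J%:R * (m - y) <= J%:R * (e / 8))%R by rewrite ler_pM2l.
rewrite /h; lra.
Qed.

End law_of_large_numbers.

(** * Averages over customers and over time *)

Section averages.
Context {R : realType}.
Local Notation leb := (@lebesgue_measure R).

Lemma lebesgue_measure_itvoc (x y e : R) : y - x <= e -> 0 <= e ->
  (leb `]x, y]%classic <= e%:E)%E.
Proof.
move=> xy e0; rewrite lebesgue_measure_itv /= lte_fin.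
by case: ifP => _; rewrite ?lee_fin// -EFinB lee_fin.
Qed.

Lemma lebesgue_measure_cover (A B C : set R) : measurable A -> measurable B ->
  measurable C -> A `<=` B `|` C -> (leb A <= leb B + leb C)%E.
Proof.
move=> mA mB mC ABC; apply: (@le_trans _ _ (leb (B `|` C))); last exact: measureU2.
by apply: le_measure => //; rewrite inE//; exact: measurableU.
Qed.

(** The intervals (a, a + S] and (0, tau] differ by a set of length at most |S
    - tau| + min(tau, a). *)
Lemma window_shift (A : set R) (a S tau : R) : measurable A ->
  0 <= a -> 0 <= S -> 0 <= tau ->
  (leb (A `&` `]a, (a + S)%R]) <=
     leb (A `&` `]0%R, tau]) + (`|S - tau| + Num.min tau a)%R%:E)%E /\
  (leb (A `&` `]0%R, tau]) <=
     leb (A `&` `]a, (a + S)%R]) + (`|S - tau| + Num.min tau a)%R%:E)%E.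
Proof.
move=> mA a0 S0 tau0.
have min0 : 0 <= Num.min tau a by rewrite le_min tau0.
have mI x y : measurable (A `&` `]x, y]) by exact: measurableI.
split.
  apply: (@le_trans _ _ (leb (A `&` `]0%R, tau]) + leb `]Num.max a tau, (a + S)%R]%classic)%E).
    apply: lebesgue_measure_cover => // x [Ax]; rewrite /= in_itv /= => /andP[ax xS].
    have [xt|tx] := leP x tau.
      by left; split => //; rewrite /= in_itv /= xt (le_lt_trans a0 ax).
    by right; rewrite /= in_itv /= gt_max ax tx.
  rewrite leeD2l//; apply: lebesgue_measure_itvoc; last by rewrite addr_ge0.
  have := ler_norm (S - tau).
  by have [] := leP a tau => /= h; rewrite ?(min_r h) ?(min_l (ltW h)); lra.
apply: (@le_trans _ _ (leb (A `&` `]a, (a + S)%R]) +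
    (leb `]0%R, Num.min tau a]%classic + leb `](a + S)%R, tau]%classic))%E).
  apply: (@le_trans _ _ (leb (A `&` `]a, (a + S)%R]) +
    (leb (`]0%R, Num.min tau a] `|` `](a + S)%R, tau])%classic))%E).
    apply: lebesgue_measure_cover => //; first exact: measurableU.
    move=> x [Ax]; rewrite /= !in_itv /= => /andP[x0 xt].
    have [xa|ax] := leP x a; first by right; left; rewrite x0 le_min xt.
    have [xS|Sx] := leP x (a + S); first by left; split => //; rewrite ax.
    by right; right; rewrite xt.
  by rewrite leeD2l// measureU2.
rewrite leeD2l// [(`|_| + _)%R]addrC EFinD leeD//.
  by apply: lebesgue_measure_itvoc => //; rewrite subr0.
apply: lebesgue_measure_itvoc => //.
by have := ler_norm (tau - S); rewrite distrC; lra.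
Qed.

Lemma cvg_sum_ord (S : Type) (F : set_system S) {FF : Filter F} n
    (u : 'I_n -> S -> R) (l : 'I_n -> R) :
  (forall k, u k x @[x --> F] --> l k) ->
  (\sum_k u k x) @[x --> F] --> \sum_k l k.
Proof.
elim: n u l => [|n IH] u l ul.
  rewrite big_ord0; under eq_fun do rewrite big_ord0.
  exact: cvg_cst.
rewrite big_ord_recr; under eq_fun do rewrite big_ord_recr.
by apply: cvgD; [apply: IH => k; exact: ul|exact: ul].
Qed.

Lemma cesaro_eps (u : nat -> R) (l e : R) : 0 < e -> u j @[j --> \oo] --> l ->
  exists J0, forall J, (J0 <= J)%N -> `|\sum_(j < J) u j - J%:R * l| <= e * J%:R.
Proof.
move=> e0 /cesaro /cvgrPdist_le /(_ _ e0) [n0 _ H].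
exists n0.+1 => -[//|J]; rewrite ltnS => nJ; have := H J nJ.
rewrite /arithmetic_mean /= /series /= big_mkord => h.
have J0 : 0 < J.+1%:R :> R by rewrite ltr0n.
rewrite distrC.
have -> : J.+1%:R * l - \sum_(j < J.+1) u j =
    J.+1%:R * (l - J.+1%:R^-1 * \sum_(j < J.+1) u j).
  by rewrite mulrBr mulVKf// gt_eqF.
by rewrite normrM gtr0_norm// mulrC ler_pM2r.
Qed.

(** After some time M the function is within e / 2 of its limit, and before M
    it is off by at most 1. *)
Lemma cesaro_integral (f : R -> R) (l e : R) : 0 < e ->
  measurable_fun setT f -> (forall t, 0 <= f t <= 1) ->
  f t @[t --> +oo] --> l ->
  exists2 t0, 0 <= t0 & forall tau, t0 <= tau ->
    (\int[leb]_(t in `]0%R, tau]) (f t)%:E <= (l * tau + e * tau)%:E)%E /\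
    ((l * tau)%:E <= \int[leb]_(t in `]0%R, tau]) (f t)%:E + (e * tau)%:E)%E.
Proof.
move=> e0 mf f01 fl.
have l0 : 0 <= l.
  apply: (@cvgr_to_ge _ _ _ _ _ _ _ fl); apply: nearW => t.
  by case/andP: (f01 t).
have e20 : 0 < e / 2 by rewrite divr_gt0.
have /cvgrPdist_le /(_ _ e20) [M0 [_ HM]] := fl.
pose M := Num.max M0 0.
have M_ge0 : 0 <= M by rewrite le_max lexx orbT.
have HM' t : M < t -> `|l - f t| <= e / 2.
  by move=> Mt; apply: HM; apply: le_lt_trans Mt; rewrite le_max lexx.
(* The initial stretch of length M is negligible once M <= e * tau / 2. *)
exists (2 * M / e); first by rewrite divr_ge0 ?mulr_ge0// ltW.
move=> tau tauM.
have {tauM} eM : M <= e / 2 * tau.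
  by move: tauM; rewrite ler_pdivrMr//; lra.
have tau0 : 0 <= tau by rewrite -(pmulr_rge0 _ e20) (le_trans M_ge0).
set D := `]0%R, tau]%classic.
have mD : measurable D by exact: measurable_itv.
have lD : leb D = tau%:E.
  rewrite lebesgue_measure_itv /= lte_fin; case: ltP => [_|tau_le0].
    by rewrite -EFinB subr0.
  by congr EFin; apply/eqP; rewrite eq_le tau0 tau_le0.
pose B := `]-oo, M]%classic.
have mB : measurable B by exact: measurable_itv.
have mBf : measurable_fun D (fun t => (\1_B t)%:E : \bar R).
  by apply/measurable_EFinP; exact: measurable_indic.
have mfD : measurable_fun D (fun t => (f t)%:E : \bar R).
  by apply/measurable_EFinP; exact: measurable_funTS.
have intB : (\int[leb]_(t in D) (\1_B t)%:E <= (e / 2 * tau)%:E)%E.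
  rewrite integral_indic//; apply: (@le_trans _ _ (leb `]0%R, M]%classic)).
    apply: le_measure; rewrite ?inE//; first exact: measurableI.
    by move=> t []; rewrite /B /D /= !in_itv /= => tM /andP[t0 _]; rewrite t0 tM.
  by apply: lebesgue_measure_itvoc => //; rewrite ?subr0 ?mulr_ge0// ltW.
have intC (k : R) : (\int[leb]_(t in D) k%:E = (k * tau)%:E)%E.
  transitivity (k%:E * leb D)%E; last by rewrite lD.
  exact: (integral_cst leb mD k%:E).
have B0 t : (0 <= (\1_B t)%:E :> \bar R)%E by rewrite lee_fin.
have BE t : (t <= M /\ \1_B t = 1 :> R) \/ (M < t /\ \1_B t = 0 :> R).
  have -> : \1_B t = (t <= M)%R%:R :> R.
    rewrite indicE; have -> : (t \in B) = (t <= M); last by [].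
    by apply/idP/idP; rewrite inE /B /= in_itv.
  by have [tM|Mt] := leP t M; [left|right].
split.
- apply: (@le_trans _ _ (\int[leb]_(t in D) ((l + e / 2)%:E + (\1_B t)%:E))%E).
    apply: ge0_le_integral => //.
    + by move=> t _; rewrite lee_fin; case/andP: (f01 t).
    + by apply: emeasurable_funD => //; exact: measurable_cst.
    move=> t _; rewrite -EFinD lee_fin; have /andP[f0 f1] := f01 t.
    have [[_ ->]|[/HM' + ->]] := BE t; first by rewrite -[leLHS]add0r lerD// addr_ge0// ltW.
    by rewrite ler_norml; lra.
  rewrite ge0_integralD//; last first.
    by move=> t _; rewrite lee_fin addr_ge0// ltW.
  rewrite intC; apply: (@le_trans _ _ (((l + e / 2) * tau)%:E + (e / 2 * tau)%:E)%E).
    by rewrite leeD2l.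
  by rewrite -EFinD lee_fin; lra.
- rewrite -intC.
  apply: (@le_trans _ _ (\int[leb]_(t in D) ((f t)%:E + ((e / 2)%:E + (\1_B t)%:E)))%E).
    apply: ge0_le_integral => //.
    + by apply: emeasurable_funD => //; apply: emeasurable_funD => //; exact: measurable_cst.
    move=> t _; rewrite -!EFinD lee_fin; have /andP[f0 f1] := f01 t.
    have [[tM ->]|[/HM' + ->]] := BE t; last by rewrite ler_norml; lra.
    have : `|l - f (M + 1)| <= e / 2 by apply: HM'; lra.
    by have /andP[_] := f01 (M + 1); rewrite ler_norml; lra.
  rewrite ge0_integralD//; last 3 first.
  + by move=> t _; rewrite lee_fin; case/andP: (f01 t).
  + by move=> t _; rewrite adde_ge0// lee_fin ltW.
  + by apply: emeasurable_funD => //; exact: measurable_cst.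
  rewrite ge0_integralD//; last by move=> t _; rewrite lee_fin ltW.
  rewrite intC leeD2l//.
  apply: (@le_trans _ _ ((e / 2 * tau)%:E + (e / 2 * tau)%:E)%E); first by rewrite leeD2l.
  by rewrite -EFinD lee_fin; lra.
Qed.

End averages.

(** * The stationary probabilities *)

Lemma integral_le_add d (Omega : measurableType d) (R : realType)
    (P : {measure set Omega -> \bar R}) (f g h : Omega -> \bar R) :
  measurable_fun setT f -> measurable_fun setT g -> measurable_fun setT h ->
  (forall w, 0 <= f w)%E -> (forall w, 0 <= g w)%E -> (forall w, 0 <= h w)%E ->
  {ae P, forall w, (f w <= g w + h w)%E} ->
  (\int[P]_w f w <= \int[P]_w g w + \int[P]_w h w)%E.
Proof.
move=> mf mg mh f0 g0 h0 fgh; rewrite -ge0_integralD//.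
apply: ae_ge0_le_integral => //.
- by move=> w _; rewrite adde_ge0.
- exact: emeasurable_funD.
- by apply: filterS fgh => w + _.
Qed.

Section stationary.
Context d (Omega : measurableType d) (R : realType) (P : probability Omega R).
Variables (q0 : {RV P >-> nat}) (a0 : {RV P >-> R}).
Variables (T : nat -> {RV P >-> R}) (X : nat -> {RV P >-> nat}).
Variable V : nat -> nat -> {RV P >-> R}.
Hypothesis indep : mutually_independent P (source_events q0 a0 T X V).
Variables (c N : nat) (lambda mu : R) (b ppi p : nat -> R).
Hypothesis c_gt0 : (0 < c)%N.
Hypothesis lambda_gt0 : 0 < lambda.
Hypothesis mu_gt0 : 0 < mu.
Hypothesis V_distr : forall g m B, measurable B ->
  distribution P (V g m) B = exponential_prob mu B.
Hypothesis q0_le_N : {ae P, forall w, (q0 w <= N)%N}.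
Hypothesis a0_ge0 : {ae P, forall w, 0 <= a0 w}.
Hypothesis T_ge0 : forall j, {ae P, forall w, 0 <= T j w}.
Hypothesis T_distr : forall i j t, cdf (T i) t = cdf (T j) t.
Hypothesis T_mean : forall j, ('E_P[T j] = (lambda^-1)%:E)%E.
Hypothesis X_distr : forall j k, P [set w | X j w = k] = (b k)%:E.
Local Notation leb := (@lebesgue_measure R).
Local Notation W := (model q0 a0 T X V).
Let mW : measurable_world W := measurable_model q0 a0 T X V.
Hypothesis ppi_lim : forall k, (k <= N)%N ->
  P [set w | found_count c N (W w) j = k] @[j --> \oo] --> (ppi k)%:E.
Hypothesis p_lim : forall n, (n <= N)%N ->
  P [set w | state c N (W w) t = n] @[t --> +oo] --> (p n)%:E.

Let good_ae := ae_good indep c_gt0 mu_gt0 V_distr q0_le_N a0_ge0 T_ge0.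

Section level.
Variable n : nat.
Hypothesis n_gt0 : (0 < n)%N.
Hypothesis n_le_N : (n <= N)%N.
Local Notation down := (downcrossing q0 a0 T X V c N).

(** The limiting probability that a batch takes the number present from below n
    to n or more. *)
Definition crossing_rate : R := \sum_(k < n) ppi k * batch_tail b (n - k).

(** In [probability_balance] the two probabilities that fewer than n customers
    are found have the same limit, and cancel. *)
Lemma downcrossing_cvg : fine (P [set w | down j n w]) @[j --> \oo] --> crossing_rate.
Proof.
pose u k j := fine (P [set w | found_count c N (W w) j = k]).
have mfk j k : measurable [set w | found_count c N (W w) j = k].
  by apply: measurable_set_nat; exact: measurable_found_count.
have uE k j : P [set w | found_count c N (W w) j = k] = (u k j)%:E.
  by rewrite /u fineK// fin_num_measure.
have uk k : (k < n)%N -> u k j @[j --> \oo] --> ppi k.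
  by move=> kn; apply: fine_cvg; apply: ppi_lim; lia.
have -> : (fun j => fine (P [set w | down j n w])) = (fun j =>
    \sum_(k < n) u k j.+1 + \sum_(k < n) u k j * batch_tail b (n - k) -
    \sum_(k < n) u k j).
  apply/funext => j.
  have := probability_balance indep c_gt0 mu_gt0 V_distr q0_le_N a0_ge0 T_ge0
    X_distr j n_gt0 n_le_N.
  have mD : measurable [set w | down j n w].
    exact: (measurable_set_bool (measurable_downcrossing q0 a0 T X V N c_gt0 j n)).
  rewrite -[X in (X + _)%E](fineK (fin_num_measure P _ mD)).
  under eq_bigr do rewrite uE.
  under [X in _ = (X + _)%E]eq_bigr do rewrite uE.
  under [X in _ = (_ + X)%E]eq_bigr do rewrite uE -EFinM.
  rewrite !sumEFin -!EFinD => -[] <-.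
  by rewrite addrK.
rewrite -[crossing_rate](addKr (\sum_(k < n) ppi k)) addrC.
apply: cvgB; last by apply: cvg_sum_ord => k; exact: uk.
apply: cvgD.
  apply: (cvg_sum_ord (u := fun k j => u k j.+1)) => k.
  by rewrite (cvg_shiftS (u k)); exact: uk.
apply: (cvg_sum_ord (u := fun k j => u k j * batch_tail b (n - k))) => k.
by apply: cvgMl; exact: uk.
Qed.

(** The expected time spent in state n between arrivals 0 and J, and, in
    [clock_occupation], between times 0 and tau. *)
Definition occupation J : \bar R :=
  (\int[P]_w \int[leb]_t ind (occupied_until q0 a0 T X V c N J n (w, t)))%E.

Let kmu := (minn n c)%:R * mu.

Let kmu_gt0 : 0 < kmu.
Proof. by rewrite mulr_gt0// ltr0n leq_min n_gt0. Qed.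

Lemma occupation_flow J : occupation J =
  ((\sum_(j < J) fine (P [set w | down j n w])) / kmu)%:E.
Proof.
have H := total_flow indep c_gt0 mu_gt0 V_distr q0_le_N a0_ge0 T_ge0 J n_gt0.
have e j : P [set w | down j n w] = (fine (P [set w | down j n w]))%:E.
  rewrite fineK// fin_num_measure//.
  exact: (measurable_set_bool (measurable_downcrossing q0 a0 T X V N c_gt0 j n)).
move: H; under eq_bigr do rewrite e.
rewrite sumEFin -/(occupation J) muleA -EFinM [mu * _]mulrC -/kmu.
case: (occupation J) => [r| |].
- by rewrite -EFinM => -[->]; rewrite mulrAC divff ?mul1r// gt_eqF.
- by rewrite gt0_muley// lte_fin.
- by rewrite gt0_muleNy// lte_fin.
Qed.

Definition state_prob t : R := fine (P [set w | state c N (W w) t = n]).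

Definition in_state (z : Omega * measurableTypeR R) : bool :=
  state c N (W z.1) z.2 == n.

Lemma measurable_in_state : measurable_fun setT in_state.
Proof.
apply: (measurable_natrel (fun a b => a == b)); last exact: measurable_cst.
exact: (measurable_state N c_gt0 (measurable_model_fst q0 a0 T X V) measurable_snd).
Qed.

Lemma measurable_in_state_at t : measurable_fun setT (fun w => in_state (w, t)).
Proof.
apply: (measurableT_comp measurable_in_state).
exact: (@pair2_measurable _ _ Omega (measurableTypeR R) t).
Qed.

Lemma state_probE t : (state_prob t)%:E = (\int[P]_w ind (in_state (w, t)))%E.
Proof.
rewrite integral_ind; last exact: measurable_in_state_at.
rewrite /state_prob fineK.
  by congr (P _); apply/seteqP; split => w /= /eqP.
apply: fin_num_measure; apply: measurable_set_nat.
by apply: measurable_state => //; exact: measurable_cst.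
Qed.

Lemma measurable_state_prob : measurable_fun setT (state_prob : R -> R).
Proof.
apply/measurable_EFinP.
rewrite (_ : EFin \o _ = fun t => \int[P]_w ind (in_state (w, t)))%E; last first.
  by apply/funext => t /=; rewrite state_probE.
apply: (@measurable_fun_fubini_tonelli_G _ _ Omega (measurableTypeR R) R P
  (fun z => ind (in_state z))); first exact: measurable_ind measurable_in_state.
by move=> z; exact: ind_ge0.
Qed.

Lemma state_prob01 t : 0 <= state_prob t <= 1.
Proof.
rewrite fine_ge0//= -lee_fin state_probE.
rewrite -[leRHS](mean_cst P); apply: ge0_le_integral => //.
- by move=> w _; exact: ind_ge0.
- exact: (measurable_ind (measurable_in_state_at t)).
- by move=> w _; rewrite lee_fin; case: in_state.
Qed.

Definition clock_occupation tau : \bar R :=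
  (\int[P]_w \int[leb]_t ind ((0 < t <= tau)%R && in_state (w, t)))%E.

Lemma clock_occupationE tau :
  clock_occupation tau = (\int[leb]_(t in `]0%R, tau]) (state_prob t)%:E)%E.
Proof.
pose f (z : Omega * measurableTypeR R) := (0 < z.2 <= tau)%R && in_state z.
have mf : measurable_fun setT f.
  apply: measurable_and; last exact: measurable_in_state.
  apply: measurable_and.
    by apply: measurable_fun_ltr; [exact: measurable_cst|exact: measurable_snd].
  by apply: measurable_fun_ler; [exact: measurable_snd|exact: measurable_cst].
rewrite /clock_occupation.
rewrite (@fubini_tonelli _ _ Omega (measurableTypeR R) R P leb
  (fun z => ind (f z)) (measurable_ind mf)); last by move=> z; exact: ind_ge0.
rewrite [RHS]integral_mkcond; apply: eq_integral => t _.
rewrite patchE; case: ifPn => tt.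
  rewrite state_probE; apply: eq_integral => w _.
  by move: tt; rewrite /f inE /= in_itv /= => ->.
rewrite integral0_eq// => w _; rewrite /f.
by move: tt; rewrite notin_setE /= in_itv /= => /negP/negbTE ->.
Qed.

Definition shift_error J : \bar R :=
  (\int[P]_w (`|\sum_(j < J) T j w - J%:R * lambda^-1| +
              clip (J%:R * lambda^-1) (a0 w))%R%:E)%E.

Lemma occupation_shift J :
  (occupation J <= clock_occupation (J%:R * lambda^-1)%R + shift_error J)%E /\
  (clock_occupation (J%:R * lambda^-1)%R <= occupation J + shift_error J)%E.
Proof.
set tau := (J%:R * lambda^-1)%R.
have tau0 : 0 <= tau by rewrite mulr_ge0// invr_ge0 ltW.
pose h w : \bar R := (`|\sum_(j < J) T j w - tau| + clip tau (a0 w))%R%:E.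
have mh : measurable_fun setT h.
  apply/measurable_EFinP; apply: measurable_funD.
    by apply: measurableT_comp => //; apply: measurable_funB => //; exact: measurable_sum.
  by apply: (measurableT_comp (measurable_clip tau)).
have h0 w : (0 <= h w)%E by rewrite lee_fin addr_ge0// clip_ge0.
have mocc := measurable_occupied_until q0 a0 T X V N c_gt0 J n.
have mclock : measurable_fun setT (fun z : Omega * measurableTypeR R =>
    (0 < z.2 <= tau)%R && in_state z).
  apply: measurable_and; last exact: measurable_in_state.
  apply: measurable_and.
    by apply: measurable_fun_ltr; [exact: measurable_cst|exact: measurable_snd].
  by apply: measurable_fun_ler; [exact: measurable_snd|exact: measurable_cst].
have path w : good c N (W w) ->
    (\int[leb]_t ind (occupied_until q0 a0 T X V c N J n (w, t)) <=
     \int[leb]_t ind ((0 < t <= tau)%R && in_state (w, t)) + h w)%E /\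
    (\int[leb]_t ind ((0 < t <= tau)%R && in_state (w, t)) <=
     \int[leb]_t ind (occupied_until q0 a0 T X V c N J n (w, t)) + h w)%E.
  case=> _ a00 ga _ _.
  have mA : measurable [set t | in_state (w, t)].
    exact: (measurable_set_bool (measurable_time_slice w measurable_in_state)).
  have S0 : 0 <= \sum_(j < J) T j w by apply: sumr_ge0 => j _; exact: ga.
  have := window_shift mA a00 S0 tau0.
  rewrite (integral_ind leb (measurable_time_slice w mocc)).
  rewrite (integral_ind leb (measurable_time_slice w mclock)).
  have -> : [set t | occupied_until q0 a0 T X V c N J n (w, t)] =
      [set t | in_state (w, t)] `&` `]a0 w, a0 w + \sum_(j < J) T j w].
    apply/seteqP; split => t; rewrite /occupied_until /= in_itv /=
      /arrival /arrival_time /= big_ord0 addr0; first by move=> /andP[h1 h2]; split.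
    by move=> [h1 h2]; apply/andP.
  have -> : [set t | (0 < t <= tau) && in_state (w, t)] =
      [set t | in_state (w, t)] `&` `]0, tau].
    apply/seteqP; split => t; rewrite /= in_itv /=; first by move=> /andP[h1 h2]; split.
    by move=> [h1 h2]; apply/andP.
  by rewrite /h /clip (max_r a00).
rewrite /occupation /clock_occupation /shift_error -/tau.
have m1 := measurable_time_integral mocc.
have m2 := measurable_time_integral mclock.
have i1 w := time_integral_ge0 (occupied_until q0 a0 T X V c N J n) w.
have i2 w := time_integral_ge0
  (fun z : Omega * measurableTypeR R => (0 < z.2 <= tau)%R && in_state z) w.
split.
  by apply: (integral_le_add m1 m2 mh i1 i2 h0); apply: filterS good_ae => w /path[].
by apply: (integral_le_add m2 m1 mh i2 i1 h0); apply: filterS good_ae => w /path[].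
Qed.

(** The first arrival time need not be integrable, but it is almost surely
    finite: it exceeds the small multiple x of tau with small probability only.
    *)
Lemma first_arrival_error (e : R) : 0 < e -> exists J0, forall J, (J0 <= J)%N ->
  (\int[P]_w (clip (J%:R * lambda^-1) (a0 w))%:E <= (e * J%:R)%:E)%E.
Proof.
move=> e0; pose delta := e * lambda / 2.
have delta0 : 0 < delta by rewrite divr_gt0// mulr_gt0.
have tail0 : (fine \o ccdf a0) x @[x --> +oo] --> (0 : R).
  by apply: fine_cvg; exact: cvg_ccdfy0.
have /cvgrPdist_le /(_ _ delta0) [M0 [_ HM]] := tail0.
pose M := Num.max M0 0.
have [k tk] : exists k : nat, (M + 1) * lambda / delta <= k%:R.
  by exists (Num.truncn ((M + 1) * lambda / delta)).+1; exact: ltW (truncnS_gt _).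
exists k => J kJ; set tau := J%:R * lambda^-1; set x := delta * tau.
have tau0 : 0 <= tau by rewrite mulr_ge0// invr_ge0 ltW.
have Mx : M0 < x.
  have : (M + 1) * lambda / delta <= J%:R by rewrite (le_trans tk)// ler_nat.
  rewrite ler_pdivrMr// -ler_pdivlMr// => h.
  have -> : x = J%:R * delta / lambda by rewrite /x /tau; ring.
  have : M0 <= M by rewrite le_max lexx.
  lra.
have tail : fine (P [set w | x < a0 w]) <= delta.
  have := HM _ Mx; rewrite sub0r normrN => /(le_trans (ler_norm _)).
  rewrite /= /ccdf /distribution /pushforward.
  by rewrite (_ : _ @^-1` _ = [set w | x < a0 w])//; apply/seteqP; split => w /=;
    rewrite in_itv /= andbT.
have mx : measurable_fun setT (fun w => x < a0 w).
  by apply: measurable_fun_ltr => //; exact: measurable_cst.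
have x0 : 0 <= x by rewrite mulr_ge0// ltW.
apply: (@le_trans _ _ (\int[P]_w (x + tau * (x < a0 w)%R%:R)%:E)%E).
  apply: mean_le => //.
  - exact: (measurableT_comp (measurable_clip tau)).
  - apply: measurable_funD => //; apply: measurable_funM => //.
    exact: (measurableT_comp (measurable_from_bool (fun b : bool => b%:R : R))).
  - by move=> w; exact: clip_ge0.
  move=> w; have [ax|xa] := leP (a0 w) x.
    by rewrite mulr0 addr0 /clip ge_min ge_max x0 ax orbT.
  by rewrite mulr1 (le_trans (clip_le _ _))// lerDr.
rewrite mean_add//; last 2 first.
- apply: measurable_funM => //.
  exact: (measurableT_comp (measurable_from_bool (fun b : bool => b%:R : R))).
- by move=> w; rewrite mulr_ge0// ler0n.
rewrite mean_cst mean_scale//; last first.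
- exact: (measurableT_comp (measurable_from_bool (fun b : bool => b%:R : R))).
have Pfin : P [set w | x < a0 w] \is a fin_num.
  exact: fin_num_measure (measurable_set_bool mx).
have -> : (\int[P]_w ((x < a0 w)%R%:R)%:E)%E = (fine (P [set w | x < a0 w]))%:E.
  by rewrite fineK//; exact: (integral_ind P mx).
rewrite -EFinM -EFinD lee_fin.
have : tau * fine (P [set w | x < a0 w]) <= tau * delta by rewrite ler_wpM2l.
have -> : e * J%:R = 2 * (tau * delta) by rewrite /tau /delta; field; rewrite gt_eqF.
by rewrite /x; lra.
Qed.

Lemma shift_error_small (e : R) : 0 < e -> exists J0, forall J, (J0 <= J)%N ->
  (shift_error J <= (e * J%:R)%:E)%E.
Proof.
move=> e0; have e20 : 0 < e / 2 by rewrite divr_gt0.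
have [J1 H1] := weak_law indep T_ge0 T_distr T_mean e20.
have [J2 H2] := first_arrival_error e20.
exists (maxn J1 J2) => J; rewrite geq_max => /andP[/H1 h1 /H2 h2].
rewrite /shift_error mean_add//; last 3 first.
- by apply: measurableT_comp => //; apply: measurable_funB => //; exact: measurable_sum.
- exact: (measurableT_comp (measurable_clip _)).
- by move=> w; apply: clip_ge0; rewrite mulr_ge0// invr_ge0 ltW.
apply: (le_trans (leeD h1 h2)).
by rewrite -EFinD lee_fin -mulrDl -splitr.
Qed.

(** The expected time in state n over J interarrival times is asymptotic to J
    crossing_rate / kmu by [occupation_flow], and to the same quantity over J /
    lambda time units, that is J p n / lambda, by [shift_error_small] and
    [cesaro_integral]. Each of the three approximations has an error of at most
    e J. *)
Lemma level_balance : p n = lambda * crossing_rate / kmu.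
Proof.
suff uv : crossing_rate / kmu = p n / lambda.
  by rewrite -mulrA uv mulrC divfK// gt_eqF.
apply/eqP; rewrite -subr_eq0 -normr_eq0; apply/negPn/negP => ne.
set D := `|_| in ne; have D0 : 0 < D by rewrite lt_neqAle eq_sym ne normr_ge0.
(* Three errors of size e against the distance D = 6 e. *)
pose e := D / 6; have e0 : 0 < e by rewrite divr_gt0.
have [J1 H1] := cesaro_eps (mulr_gt0 e0 kmu_gt0) downcrossing_cvg.
have [J2 H2] := shift_error_small e0.
have pl : state_prob t @[t --> +oo] --> p n by apply: fine_cvg; exact: p_lim.
have [t0 t00 H3] := cesaro_integral (mulr_gt0 e0 lambda_gt0) measurable_state_prob
  state_prob01 pl.
have [k tk] : exists k : nat, lambda * t0 <= k%:R.
  by exists (Num.truncn (lambda * t0)).+1; exact: ltW (truncnS_gt _).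
pose J := (maxn 1 (maxn (maxn J1 J2) k))%N.
have J_gt0 : 0 < J%:R :> R by rewrite ltr0n; lia.
have tJ : t0 <= J%:R * lambda^-1.
  by rewrite ler_pdivlMr// mulrC (le_trans tk)// ler_nat /J; lia.
have {}H1 : `|\sum_(j < J) fine (P [set w | down j n w]) - J%:R * crossing_rate| <=
    e * kmu * J%:R by apply: H1; rewrite /J; lia.
have {}H2 : (shift_error J <= (e * J%:R)%:E)%E by apply: H2; rewrite /J; lia.
have [H31 H32] := H3 _ tJ.
have [H4 H5] := occupation_shift J.
move: H31 H32; rewrite -clock_occupationE => H31 H32.
rewrite occupation_flow in H4 H5.
set i := (\sum_(j < J) _)%R in H1 H4 H5.
have E1 : (i / kmu <= p n * (J%:R / lambda) + e * lambda * (J%:R / lambda) + e * J%:R)%R.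
  rewrite -lee_fin; apply: (le_trans H4).
  by rewrite EFinD leeD.
have E2 : (p n * (J%:R / lambda) <= i / kmu + e * J%:R + e * lambda * (J%:R / lambda))%R.
  rewrite -lee_fin; apply: (le_trans H32).
  by rewrite EFinD leeD2r// (le_trans H5)// EFinD leeD2l.
have lE : e * lambda * (J%:R / lambda) = e * J%:R.
  by field; rewrite gt_eqF.
rewrite lE in E1 E2.
have pE : p n * (J%:R / lambda) = J%:R * (p n / lambda) by ring.
rewrite pE in E1 E2.
have E3 : `|i / kmu - J%:R * (crossing_rate / kmu)| <= e * J%:R.
  have -> : i / kmu - J%:R * (crossing_rate / kmu) = (i - J%:R * crossing_rate) / kmu.
    by rewrite mulrBl mulrA.
  by rewrite normrM (gtr0_norm (_ : 0 < kmu^-1)) ?invr_gt0// ler_pdivrMr// mulrAC.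
have : J%:R * D <= J%:R * (3 * e).
  rewrite /D -[J%:R in leLHS]gtr0_norm// -normrM mulrBr.
  by move: E3; rewrite !ler_norml; lra.
by rewrite ler_pM2l// /e; lra.
Qed.

End level.

(** At each time the state is almost surely at most N. *)
Lemma total_probability : p 0%N = 1 - \sum_(1 <= k < N.+1) p k.
Proof.
have H t : \sum_(k < N.+1) state_prob k t = 1.
  apply: EFin_inj; rewrite -sumEFin.
  under eq_bigr do rewrite state_probE.
  rewrite -ge0_integral_sum//; last 2 first.
  - by move=> k; exact: (measurable_ind (measurable_in_state_at k t)).
  - by move=> k w _; exact: ind_ge0.
  rewrite -[RHS](mean_cst P); apply: ge0_ae_eq_integral => //.
  - apply: emeasurable_sum => k.
    exact: (measurable_ind (measurable_in_state_at k t)).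
  - by move=> w _; apply: sume_ge0 => k _; exact: ind_ge0.
  apply: filterS good_ae => w [h1 h2 h3 _ _] _.
  rewrite /ind -sum_natE /in_state /= sum_eq_ord1 ltnS.
  by rewrite (state_le c h2 h3 h1).
have : (\sum_(k < N.+1) state_prob k t) @[t --> +oo] --> \sum_(k < N.+1) p k.
  apply: cvg_sum_ord => k; apply: fine_cvg; apply: p_lim.
  by rewrite -ltnS.
under eq_fun do rewrite H.
move=> /cvg_unique -/(_ (@norm_hausdorff _ _) 1 (cvg_cst _)) S1.
have : \sum_(k < N.+1) p k = 1 by [].
rewrite -(big_mkord xpredT p) big_ltn// => <-.
by rewrite addrK.
Qed.

End stationary.

Unset Implicit Arguments.

Theorem lemma3p4 (R : realType) (d : measure_display)
    (Omega : measurableType d) (P : probability Omega R)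
    (c N : nat) (lambda mu : R) (A : R -> R) (b : nat -> R)
    (q0 : {RV P >-> nat}) (a0 : {RV P >-> R})
    (T : nat -> {RV P >-> R}) (X : nat -> {RV P >-> nat})
    (V : nat -> nat -> {RV P >-> R})
    (ppi p : nat -> R)
    (c_gt0 : (0 < c)%N) (c_le_N : (c <= N)%N)
    (lambda_gt0 : 0 < lambda) (mu_gt0 : 0 < mu)
    (q0_le_N : {ae P, forall w, (q0 w <= N)%N})
    (a0_ge0 : {ae P, forall w, 0 <= a0 w})
    (T_ge0 : forall j, {ae P, forall w, 0 <= T j w})
    (T_distr : forall j t, cdf (T j) t = (A t)%:E)
    (T_mean : forall j, ('E_P[T j] = (lambda^-1)%:E)%E)
    (X_distr : forall j k, P [set w | X j w = k] = (b k)%:E)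
    (X_support : b 0%N = 0)
    (V_distr : forall g m B, measurable B ->
      distribution P (V g m) B = exponential_prob mu B)
    (indep : mutually_independent P (source_events q0 a0 T X V))
    (ppi_lim : forall k, (k <= N)%N ->
      P [set w | found c N (q0 w) (a0 w) (T ^~ w) (X ^~ w)
                   (fun g m => V g m w) j = k]
        @[j --> \oo] --> (ppi k)%:E)
    (p_lim : forall n, (n <= N)%N ->
      P [set w | in_system c N (q0 w) (a0 w) (T ^~ w) (X ^~ w)
                   (fun g m => V g m w) t = n]
        @[t --> +oo] --> (p n)%:E) :
  (forall n, (1 <= n <= N)%N ->
     p n = lambda * (\sum_(0 <= k < n) ppi k * batch_tail b (n - k)%N)
           / ((minn n c)%:R * mu)) /\
  p 0%N = 1 - \sum_(1 <= k < N.+1) p k.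
Proof.
have T_same i j t : cdf (T i) t = cdf (T j) t by rewrite !T_distr.
split; last exact: (total_probability indep c_gt0 mu_gt0 V_distr q0_le_N a0_ge0
  T_ge0 p_lim).
move=> n /andP[n_gt0 n_le_N]; rewrite big_mkord.
exact: (level_balance indep c_gt0 lambda_gt0 mu_gt0 V_distr q0_le_N a0_ge0 T_ge0
  T_same T_mean X_distr ppi_lim p_lim n_gt0 n_le_N).
Qed.
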